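(* Let $G$ be a finite simple biconnected graph which is complete intersection. Then every minimal generator of $I_G$ is (up to sign) of the form $B_w$ where $w$ is an even cycle of $G$.
   Context: A graph is biconnected if it is connected and has no cut vertex. For a finite simple graph $G$ with edges $e_1,\dots,e_m$ and a field $K$, the toric ideal $I_G\subseteq K[e_1,\dots,e_m]$ is the kernel of the $K$-algebra map $e_i=\{v_j,v_k\}\mapsto v_jv_k$; $G$ is complete intersection if $I_G$ is generated by $\operatorname{ht}(I_G)$ elements. A minimal generator of $I_G$ is a binomial belonging to at least one minimal system of binomial generators of $I_G$. For an even cycle $w=(e_{i_1},\dots,e_{i_{2q}})$ (edges listed in order), $B_w=\prod_{k=1}^q e_{i_{2k-1}}-\prod_{k=1}^q e_{i_{2k}}$. *)

(* Defs.v *)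
From Stdlib Require Import List.
From HB Require Import structures.
From mathcomp Require Import all_boot all_order all_algebra.
Set Implicit Arguments. Unset Strict Implicit. Unset Printing Implicit Defensive.
Import Order.TTheory GRing.Theory Num.Theory.
Local Open Scope ring_scope.

Fixpoint mpoly (R : comNzRingType) (k : nat) : comNzRingType :=
  match k with
  | 0 => R
  | k'.+1 => ({poly mpoly R k'} : comNzRingType)
  end.

(* the variable x_i (i < k); x_{k-1} is the outermost 'X *)
Fixpoint mvar (R : comNzRingType) (k : nat) (i : nat) : mpoly R k :=
  match k return mpoly R k with
  | 0 => 0
  | k'.+1 => if i == k' then ('X : {poly mpoly R k'}) else (@mvar R k' i)%:P
  end.

Fixpoint mconst (R : comNzRingType) (k : nat) (c : R) : mpoly R k :=
  match k return mpoly R k with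
  | 0 => c
  | k'.+1 => (@mconst R k' c)%:P
  end.

Fixpoint meval (R S : comNzRingType) (g : R -> S) (f : nat -> S) (k : nat)
  : mpoly R k -> S :=
  match k return mpoly R k -> S with
  | 0 => g
  | k'.+1 => fun p : {poly mpoly R k'} => (map_poly (@meval R S g f k') p).[f k']
  end.

Definition is_ideal (A : comNzRingType) (I : A -> Prop) : Prop :=
  [/\ I 0, (forall x y, I x -> I y -> I (x + y)) & (forall a x, I x -> I (a * x))].

Definition is_prime_ideal (A : comNzRingType) (P : A -> Prop) : Prop :=
  [/\ is_ideal P, ~ P 1 & (forall a b, P (a * b) -> P a \/ P b)].

Definition prime_chain_to (A : comNzRingType) (P : A -> Prop) (l : nat) : Prop :=
  exists c : nat -> A -> Prop,
    [/\ forall i, (i <= l)%N -> is_prime_ideal (c i),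
        forall i, (i < l)%N ->
          (forall x, c i x -> c i.+1 x) /\ (exists x, c i.+1 x /\ ~ c i x)
      & forall x, c l x <-> P x].

Definition prime_height (A : comNzRingType) (P : A -> Prop) (h : nat) : Prop :=
  prime_chain_to P h /\ ~ prime_chain_to P h.+1.

Definition ideal_height (A : comNzRingType) (I : A -> Prop) (h : nat) : Prop :=
  (exists P : A -> Prop, [/\ is_prime_ideal P, (forall x, I x -> P x)
                            & prime_height P h]) /\
  (forall (P : A -> Prop) (h' : nat), is_prime_ideal P -> (forall x, I x -> P x) ->
       prime_height P h' -> (h <= h')%N).

Definition in_ideal_gen (A : comNzRingType) (S : A -> Prop) (p : A) : Prop :=
  exists l : seq (A * A),
    (forall x, List.In x l -> S x.2) /\ p = \sum_(x <- l) x.1 * x.2.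

Definition generates (A : comNzRingType) (S : A -> Prop) (I : A -> Prop) : Prop :=
  forall p, I p <-> in_ideal_gen S p.

(* A finite simple graph on vertices 'I_n with edges e_0..e_{m-1}:
   edge i is the unordered pair {(E i).1, (E i).2}, stored with .1 < .2;
   E injective (no multiple edges), .1 < .2 (no loops). *)
Definition simple_edges (n m : nat) (E : 'I_m -> 'I_n * 'I_n) : Prop :=
  injective E /\ (forall i, ((E i).1 < (E i).2)%N).

Definition adj (n m : nat) (E : 'I_m -> 'I_n * 'I_n) : rel 'I_n :=
  fun x y => [exists i, (E i == (x, y)) || (E i == (y, x))].

(* the subgraph induced on S is connected (vacuous if S is empty) *)
Definition connected_on (n m : nat) (E : 'I_m -> 'I_n * 'I_n) (S : {set 'I_n}) : Prop :=
  forall x y, x \in S -> y \in S ->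
    connect (fun a b => [&& a \in S, b \in S & adj E a b]) x y.

Definition connected (n m : nat) (E : 'I_m -> 'I_n * 'I_n) : Prop :=
  connected_on E [set: 'I_n].

Definition cut_vertex (n m : nat) (E : 'I_m -> 'I_n * 'I_n) (v : 'I_n) : Prop :=
  ~ connected_on E (~: [set v]).

Definition biconnected (n m : nat) (E : 'I_m -> 'I_n * 'I_n) : Prop :=
  connected E /\ (forall v, ~ cut_vertex E v).

Definition edge_map (K : fieldType) (n m : nat) (E : 'I_m -> 'I_n * 'I_n)
  : mpoly K m -> mpoly K n :=
  @meval K (mpoly K n) (@mconst K n) (fun i : nat =>
     if (i < m)%N =P true is ReflectT Hi then
       @mvar K n (E (Ordinal Hi)).1 * @mvar K n (E (Ordinal Hi)).2
     else 0) m.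

Definition toric_ideal (K : fieldType) (n m : nat) (E : 'I_m -> 'I_n * 'I_n)
  : mpoly K m -> Prop :=
  fun p => edge_map E p = 0.
Arguments toric_ideal K {n m} E.

Definition complete_intersection (K : fieldType) (n m : nat)
  (E : 'I_m -> 'I_n * 'I_n) : Prop :=
  exists h : nat, ideal_height (toric_ideal K E) h /\
    exists gs : seq (mpoly K m),
      size gs = h /\ generates (fun p => List.In p gs) (toric_ideal K E).

Arguments complete_intersection K {n m} E.

Definition monomial (K : fieldType) (m : nat) (a : 'I_m -> nat) : mpoly K m :=
  \prod_(i < m) @mvar K m i ^+ a i.

Definition is_binomial (K : fieldType) (m : nat) (p : mpoly K m) : Prop :=
  exists a b : 'I_m -> nat, p = @monomial K m a - @monomial K m b.

Definition minimal_binomial_gen_system (K : fieldType) (m : nat)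
  (I : mpoly K m -> Prop) (S : mpoly K m -> Prop) : Prop :=
  [/\ forall p, S p -> is_binomial p,
      generates S I
    & forall S' : mpoly K m -> Prop, (forall p, S' p -> S p) -> generates S' I ->
        forall p, S p -> S' p].

Definition minimal_generator (K : fieldType) (m : nat)
  (I : mpoly K m -> Prop) (f : mpoly K m) : Prop :=
  exists S, minimal_binomial_gen_system I S /\ S f.

Definition even_cycle (n m : nat) (E : 'I_m -> 'I_n * 'I_n) (q : nat)
  (vs : 'I_(q.*2) -> 'I_n) (es : 'I_(q.*2) -> 'I_m) : Prop :=
  (2 <= q)%N /\ injective vs /\
  forall k : 'I_(q.*2),
    let k' := (k.+1 %% q.*2)%N in
    exists Hk' : (k' < q.*2)%N,
      (E (es k) == (vs k, vs (Ordinal Hk'))) || (E (es k) == (vs (Ordinal Hk'), vs k)).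

(* B_w = e_{i_1} e_{i_3} ... e_{i_{2q-1}} - e_{i_2} e_{i_4} ... e_{i_{2q}}
   (1-indexed as in the paper; here positions 0,2,.. and 1,3,..) *)
Definition B_w (K : fieldType) (m q : nat) (es : 'I_(q.*2) -> 'I_m) : mpoly K m :=
  \prod_(k < q.*2 | ~~ odd k) @mvar K m (es k) - \prod_(k < q.*2 | odd k) @mvar K m (es k).
Arguments B_w K {m q} es.

(* Main.v *)
Require Import Defs.
From Stdlib Require Import Classical ClassicalEpsilon FunctionalExtensionality.
From HB Require Import structures.
From mathcomp Require Import all_boot all_order all_algebra.
From mathcomp Require Import zify ring lra.
Set Implicit Arguments. Unset Strict Implicit. Unset Printing Implicit Defensive.
Import Order.TTheory GRing.Theory Num.Theory.
Local Open Scope ring_scope.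

(** Let S be a minimal binomial generating system containing f = x^u - x^v, let
    A be the incidence map, and suppose that f is not an even cycle binomial.

    - Along a chain of primes ending at I_G, elements witnessing the strict
      inclusions, together with rank A independent edges, are algebraically
      independent; counting monomials gives ht I_G <= m - rank A.
    - The linear functional summing the coefficients of the monomials congruent
      to x^u modulo the ideal generated by S \ {f} kills (maximal ideal) I_G and
      S \ {f}, but not f.  Hence |S| <= ht I_G, and f is primitive.
    - Let phi be a weight on edges vanishing on the exponent vectors of S \ {f}.
      The binomial of an even cycle C has square-free degree.  If f had degree
      dividing it, f would be a difference of two disjoint matchings on the same
      vertices, hence by primitivity an even cycle.  So f does not contribute to
      the binomial of C, and phi vanishes on C.
    - In a biconnected graph a weight vanishing on all even cycles has the form
      phi(xy) = p(x) + p(y): grow p along an ear decomposition.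
    - Therefore m - (|S| - 1) <= rank A, contradicting |S| <= m - rank A. *)

(** * Evaluation and linear functionals on iterated polynomial rings *)

Lemma mconst_is_zmod_morphism (R : comNzRingType) k :
  zmod_morphism (@mconst R k).
Proof. by elim: k => [|k IH] x y //=; rewrite IH raddfB. Qed.

Lemma mconst_is_monoid_morphism (R : comNzRingType) k :
  monoid_morphism (@mconst R k).
Proof.
elim: k => [|k [IH1 IHM]] //=; split=> [|x y]; first by rewrite IH1.
by rewrite IHM rmorphM.
Qed.

HB.instance Definition _ (R : comNzRingType) k :=
  GRing.isZmodMorphism.Build R (mpoly R k) (@mconst R k)
    (@mconst_is_zmod_morphism R k).
HB.instance Definition _ (R : comNzRingType) k :=
  GRing.isMonoidMorphism.Build R (mpoly R k) (@mconst R k)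
    (@mconst_is_monoid_morphism R k).

Section Meval.
Variables (R S : comNzRingType) (g : {rmorphism R -> S}) (f : nat -> S).

Lemma meval_morphism k :
  zmod_morphism (@meval R S g f k) /\ monoid_morphism (@meval R S g f k).
Proof.
elim: k => [|k [IHa IHm]] /=.
  by split; [exact: raddfB | split; [exact: rmorph1 | exact: rmorphM]].
pose Ha := GRing.isZmodMorphism.Build _ _ (@meval R S g f k) IHa.
pose Hm := GRing.isMonoidMorphism.Build _ _ (@meval R S g f k) IHm.
(* The induction hypothesis is packed as a ring morphism so that [map_poly h] becomes one too. *)
pose h : {rmorphism mpoly R k -> S} := HB.pack (@meval R S g f k) Ha Hm.
split=> [p q|]; first by rewrite (raddfB (map_poly h)) hornerD hornerN.
split=> [|p q]; first by rewrite (rmorph1 (map_poly h)) hornerC.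
by rewrite (rmorphM (map_poly h)) hornerM.
Qed.

HB.instance Definition _ k := GRing.isZmodMorphism.Build (mpoly R k) S
  (@meval R S g f k) (proj1 (meval_morphism k)).
HB.instance Definition _ k := GRing.isMonoidMorphism.Build (mpoly R k) S
  (@meval R S g f k) (proj2 (meval_morphism k)).

Lemma meval_const k c : meval g f (mconst k c) = g c.
Proof. by elim: k => [|k IH] //=; rewrite map_polyC hornerC /= IH. Qed.

Lemma meval_var k i : (i < k)%N -> meval g f (mvar R k i) = f i.
Proof.
elim: k => [|k IH] //= lt_ik; case: eqP => [->|/eqP ne_ik].
  by rewrite map_polyX hornerX.
by rewrite map_polyC hornerC /= IH //; lia.
Qed.

End Meval.

Section Mono.
Variable R : comNzRingType.

Definition mono k (a : nat -> nat) : mpoly R k := \prod_(i < k) mvar R k i ^+ a i.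

Lemma monoS k a :
  mono k.+1 a = ((mono k a)%:P * 'X^(a k) : {poly mpoly R k}).
Proof.
rewrite /mono big_ord_recr /= eqxx rmorph_prod; congr (_ * _).
apply: eq_bigr => i _; rewrite rmorphXn /=.
by rewrite (ltn_eqF (ltn_ord i)).
Qed.

(** An induction principle: an additive statement needs checking only on scalar multiples of
    monomials. The outer polynomial is split by powers of its variable, and each coefficient falls
    to the inner induction. *)
Lemma mpoly_span k (Q : mpoly R k -> Prop) :
  Q 0 -> (forall p q, Q p -> Q q -> Q (p + q)) ->
  (forall c a, Q (mconst k c * mono k a)) -> forall p, Q p.
Proof.
elim: k Q => [|k IH] Q Q0 QD Qm p.
  by have := Qm p (fun=> 0%N); rewrite /mono big_ord0 mulr1.
have QC (q : mpoly R k) (j : nat) : Q (q%:P * 'X^j : {poly mpoly R k}).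
  move: q; apply: IH => [|q1 q2 H1 H2|c a].
  - by rewrite mul0r.
  - by rewrite polyCD mulrDl; apply: QD.
  - pose b i := if i == k then j else a i.
    have -> : ((mconst k c * mono k a)%:P * 'X^j : {poly mpoly R k})
       = mconst k.+1 c * mono k.+1 b :> {poly mpoly R k}.
      rewrite monoS /= polyCM -mulrA /b eqxx; do 2 congr (_ * _).
      congr polyC; apply: eq_bigr => i _.
      by rewrite (ltn_eqF (ltn_ord i)).
    exact: Qm.
have -> : p = \sum_(i < size (p : {poly mpoly R k}))
    ((p : {poly _})`_i)%:P * 'X^i :> {poly mpoly R k}.
  rewrite -[LHS]coefK poly_def; apply: eq_bigr => i _.
  by rewrite mul_polyC.
by elim/big_ind: _ => // i _; exact: QC.
Qed.

(* The R-linear functional sending the monomial x^a to w a. *)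
Fixpoint lam k (w : (nat -> nat) -> R) : mpoly R k -> R :=
  match k return mpoly R k -> R with
  | 0 => fun p => p * w (fun=> 0%N)
  | k'.+1 => fun p : {poly mpoly R k'} =>
     \sum_(i < size p)
        @lam k' (fun a => w (fun j => if j == k' then val i else a j)) p`_i
  end.

(** Coefficients beyond the size are zero and contribute nothing. A common range lets polynomials of
    different sizes be added term by term. *)
Lemma lam_wider k w (N : nat) (p : {poly mpoly R k}) :
  (forall w', @lam k w' 0 = 0) -> (size p <= N)%N ->
  @lam k.+1 w p =
  \sum_(i < N) @lam k (fun a => w (fun j => if j == k then val i else a j)) p`_i.
Proof.
move=> lam0 leN /=.
rewrite (big_ord_widen N
  (fun i => @lam k (fun a => w (fun j => if j == k then i else a j)) p`_i)) //.
rewrite [RHS](bigID (fun i : 'I_N => (i < size p)%N)) /= [X in _ = _ + X]big1 ?addr0 //.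
by move=> i; rewrite -leqNgt => le_i; rewrite nth_default.
Qed.

Lemma lam0 k w : @lam k w 0 = 0.
Proof. by case: k w => [|k] w /=; rewrite ?mul0r // size_poly0 big_ord0. Qed.

Lemma lamD k w p q : @lam k w (p + q) = lam w p + lam w q.
Proof.
elim: k w p q => [|k IH] w p q; first by rewrite /= mulrDl.
pose N := maxn (size (p : {poly mpoly R k})) (size (q : {poly mpoly R k})).
rewrite !(@lam_wider _ _ N) ?leq_maxl ?leq_maxr //; try by exact: lam0.
  by rewrite -big_split; apply: eq_bigr => i _; rewrite coefD IH.
exact: size_polyD.
Qed.

Lemma lam_sum k w (I : Type) (r : seq I) (P : pred I) F :
  @lam k w (\sum_(i <- r | P i) F i) = \sum_(i <- r | P i) lam w (F i).
Proof. by rewrite (big_morph (@lam k w) (@lamD k w) (@lam0 k w)). Qed.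

Lemma lam_const k w c p : @lam k w (mconst k c * p) = c * lam w p.
Proof.
elim: k w p => [|k IH] w p; first by rewrite /= mulrA.
rewrite (@lam_wider _ _ (size (p : {poly mpoly R k}))); first last.
- by rewrite /= mul_polyC size_scale_leq.
- exact: lam0.
by rewrite /= mulr_sumr; apply: eq_bigr => i _; rewrite coefCM IH.
Qed.

Lemma lam_mono k w a :
  @lam k w (mono k a) = w (fun j => if (j < k)%N then a j else 0%N).
Proof.
elim: k w => [|k IH] w; first by rewrite /= /mono big_ord0 mul1r.
rewrite monoS (@lam_wider _ _ (a k).+1); first last.
- by rewrite mul_polyC (leq_trans (size_scale_leq _ _)) // size_polyXn.
- exact: lam0.
rewrite (bigD1 ord_max) //= big1 ?addr0 => [|i ne_i].
  rewrite coefCM coefXn eqxx mulr1 IH; congr w.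
  apply: functional_extensionality => j; rewrite ltnS.
  by case: (ltngtP j k) => // ->.
rewrite coefCM coefXn; case: eqP => [E|_]; last by rewrite mulr0 lam0.
by case/eqP: ne_i; apply: val_inj.
Qed.

End Mono.

(** * Monomials and the toric ideal *)

Notation expo m := {ffun 'I_m -> nat}.

Definition addx m (a b : expo m) : expo m := [ffun i => a i + b i]%N.
Definition subx m (a b : expo m) : expo m := [ffun i => a i - b i]%N.
Definition zerox m : expo m := [ffun=> 0%N].
Definition lex m (a b : expo m) := [forall i, a i <= b i]%N.

Lemma addxI m (c a b : expo m) : addx a c = addx b c -> a = b.
Proof.
by move=> /ffunP H; apply/ffunP => i; have := H i; rewrite !ffunE => /addIn.
Qed.

Section Monomials.
Variables (K : fieldType) (m : nat).
Implicit Types (a b : expo m) (p q : mpoly K m).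

Lemma monomial_ffun (a : 'I_m -> nat) : monomial K a = monomial K (finfun a).
Proof. by apply: eq_bigr => i _; rewrite ffunE. Qed.

Lemma is_binomialP p : is_binomial p ->
  exists a b : expo m, p = monomial K a - monomial K b.
Proof.
move=> [a [b ->]]; exists (finfun a), (finfun b).
by rewrite (monomial_ffun a) (monomial_ffun b).
Qed.

Lemma mono_monomial (a : nat -> nat) :
  mono K m a = monomial K [ffun i : 'I_m => a i].
Proof. by apply: eq_bigr => i _; rewrite ffunE. Qed.

Definition extx a (i : nat) := if insub i is Some j then a j else 0%N.

Lemma extx_ord a (i : 'I_m) : extx a i = a i.
Proof. by rewrite /extx valK. Qed.

Lemma monomial_mono a : monomial K a = mono K m (extx a).
Proof. by apply: eq_bigr => i _; rewrite extx_ord. Qed.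

Lemma monomial_span (Q : mpoly K m -> Prop) :
  Q 0 -> (forall p q, Q p -> Q q -> Q (p + q)) ->
  (forall c a, Q (mconst m c * monomial K a)) -> forall p, Q p.
Proof.
by move=> Q0 QD Qm; apply: mpoly_span => // c a; rewrite mono_monomial.
Qed.

(** The linear functional with prescribed values on monomials. Such functionals express that the
    monomials form a basis: they separate exponents, read off coefficients and detect non-membership
    in ideals. *)
Definition Lam (w : expo m -> K) p : K :=
  lam (fun s => w [ffun i : 'I_m => s i]) p.

Lemma LamD w p q : Lam w (p + q) = Lam w p + Lam w q.
Proof. exact: lamD. Qed.

Lemma Lam0 w : Lam w 0 = 0.
Proof. exact: lam0. Qed.

Lemma Lam_const w c p : Lam w (mconst m c * p) = c * Lam w p.
Proof. exact: lam_const. Qed.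

Lemma LamN w p : Lam w (- p) = - Lam w p.
Proof. by apply/eqP; rewrite -addr_eq0 -LamD addNr Lam0. Qed.

Lemma LamB w p q : Lam w (p - q) = Lam w p - Lam w q.
Proof. by rewrite LamD LamN. Qed.

Lemma Lam_sum w (I : Type) (r : seq I) (P : pred I) F :
  Lam w (\sum_(i <- r | P i) F i) = \sum_(i <- r | P i) Lam w (F i).
Proof. exact: lam_sum. Qed.

Lemma Lam_monomial w a : Lam w (monomial K a) = w a.
Proof.
rewrite monomial_mono /Lam lam_mono; congr w.
by apply/ffunP => i; rewrite ffunE ltn_ord extx_ord.
Qed.

Lemma monomial_inj a b : monomial K a = monomial K b -> a = b.
Proof.
move=> /(congr1 (Lam (fun c => (c == a)%:R))); rewrite !Lam_monomial eqxx.
by case: eqP => // _ /eqP; rewrite oner_eq0.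
Qed.

Lemma monomialD a b : monomial K (addx a b) = monomial K a * monomial K b.
Proof.
by rewrite /monomial -big_split; apply: eq_bigr => i _; rewrite ffunE exprD.
Qed.

Lemma monomial0 : monomial K (zerox m) = 1.
Proof. by rewrite /monomial big1 // => i _; rewrite ffunE. Qed.

(** The constant term; its kernel is the maximal ideal generated by the variables. *)
Definition eval0 (p : mpoly K m) : K := meval idfun (fun=> 0) p.

Lemma eval0_monomial a : eval0 (monomial K a) = (a == zerox m)%:R.
Proof.
rewrite /eval0 rmorph_prod /=.
under eq_bigr => i _ do rewrite rmorphXn /= meval_var // expr0n.
case: eqP => [->|/eqP nz]; first by rewrite big1 // => i _; rewrite ffunE.
case: (boolP [exists i, a i != 0%N]) => [/existsP[i ai]|].
  by rewrite (bigD1 i) //= (negPf ai) mul0r.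
rewrite negb_exists => /forallP H; case/eqP: nz; apply/ffunP => i.
by have := H i; rewrite negbK ffunE => /eqP.
Qed.

Lemma add0x a : addx (zerox m) a = a.
Proof. by apply/ffunP => i; rewrite !ffunE. Qed.

Lemma subxK a b : lex b a -> addx (subx a b) b = a.
Proof.
by move=> /forallP le; apply/ffunP => i; rewrite !ffunE subnK.
Qed.

End Monomials.

Section Toric.
Variables (K : fieldType) (n m : nat) (E : 'I_m -> 'I_n * 'I_n).
Implicit Types (a b : expo m) (p q : mpoly K m).

Definition inc (e : 'I_m) (x : 'I_n) : nat := ((E e).1 == x) + ((E e).2 == x).

(** The product of [a] with the incidence matrix, hence the exponent of the image of the monomial
    [a] under the edge map. *)
Definition vdeg a : expo n := [ffun x => \sum_e a e * inc e x]%N.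

Definition edge_img (i : nat) : mpoly K n :=
  if (i < m)%N =P true is ReflectT Hi then
    mvar K n (E (Ordinal Hi)).1 * mvar K n (E (Ordinal Hi)).2
  else 0.

Lemma edge_imgE (i : 'I_m) :
  edge_img i = mvar K n (E i).1 * mvar K n (E i).2.
Proof.
rewrite /edge_img; case: eqP => [H|]; last by rewrite ltn_ord.
by have -> : Ordinal H = i by apply: val_inj.
Qed.

Lemma edge_mapE p : edge_map E p = meval (mconst n) edge_img p.
Proof. by []. Qed.

Lemma edge_map_monomial a : edge_map E (monomial K a) = monomial K (vdeg a).
Proof.
rewrite edge_mapE rmorph_prod /=.
have -> : monomial K (vdeg a) = \prod_(x < n) \prod_(e < m) mvar K n x ^+ (a e * inc e x).
  by apply: eq_bigr => x _; rewrite prodrXr ffunE.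
rewrite exchange_big; apply: eq_bigr => e _ /=.
rewrite rmorphXn /= meval_var // edge_imgE.
under eq_bigr => x _ do rewrite mulnC exprM exprD.
rewrite prodrXl big_split /=; congr ((_ * _) ^+ _).
  rewrite (bigD1 (E e).1) //= eqxx expr1 big1 ?mulr1 // => x.
  by rewrite eq_sym => /negPf ->.
rewrite (bigD1 (E e).2) //= eqxx expr1 big1 ?mulr1 // => x.
by rewrite eq_sym => /negPf ->.
Qed.

Lemma toric_binomial a b :
  toric_ideal K E (monomial K a - monomial K b) <-> vdeg a = vdeg b.
Proof.
rewrite /toric_ideal edge_mapE raddfB /= -!edge_mapE !edge_map_monomial.
split=> [/eqP|->]; last by rewrite subrr.
by rewrite subr_eq0 => /eqP /monomial_inj.
Qed.

Lemma vdegD a b : vdeg (addx a b) = addx (vdeg a) (vdeg b).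
Proof.
apply/ffunP => x; rewrite !ffunE -big_split; apply: eq_bigr => e _.
by rewrite ffunE mulnDl.
Qed.

Lemma vdeg_eq0 a : vdeg a = zerox n -> a = zerox m.
Proof.
move=> H; apply/ffunP => e; rewrite ffunE; apply/eqP.
have := congr1 (fun f : expo n => f (E e).1) H.
rewrite !ffunE => /eqP; rewrite sum_nat_eq0 => /forallP /(_ e) /=.
by rewrite /inc eqxx muln_eq0 addn_eq0 /= orbF.
Qed.

Lemma toric_is_ideal : is_ideal (toric_ideal K E).
Proof.
split=> [|x y Hx Hy|c x Hx]; rewrite /toric_ideal edge_mapE ?raddf0 //.
- by rewrite raddfD /= -!edge_mapE Hx Hy addr0.
- by rewrite rmorphM /= -!edge_mapE Hx mulr0.
Qed.

End Toric.

(** By induction on the number of variables, the product of two nonzero leading coefficients is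
    nonzero. Primality of the toric ideal rests on this. *)
Lemma mpoly_mulf_eq0 (K : fieldType) k (p q : mpoly K k) :
  p * q = 0 -> p = 0 \/ q = 0.
Proof.
elim: k p q => [|k IH] p q /= pq0.
  by move/eqP: pq0; rewrite mulf_eq0 => /orP [] /eqP; [left | right].
apply: NNPP => H.
have np : p != 0 by apply/eqP => Hp; apply: H; left.
have nq : q != 0 by apply/eqP => Hq; apply: H; right.
have : lead_coef p * lead_coef q != 0.
  apply/eqP => /IH [] /eqP; rewrite lead_coef_eq0; exact: negP.
move=> H0; move: (lead_coef_proper_mul H0); rewrite pq0 lead_coef0 => H1.
by move: H0; rewrite -H1 eqxx.
Qed.

Lemma toric_prime (K : fieldType) (n m : nat) (E : 'I_m -> 'I_n * 'I_n) :
  is_prime_ideal (toric_ideal K E).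
Proof.
split; first exact: toric_is_ideal.
  by rewrite /toric_ideal edge_mapE rmorph1 => /eqP; rewrite oner_eq0.
move=> a b; rewrite /toric_ideal !edge_mapE rmorphM; exact: mpoly_mulf_eq0.
Qed.

(** * An upper bound for the height *)

Lemma eq_meval (R S : comNzRingType) (g : R -> S) (f f' : nat -> S) k
    (p : mpoly R k) :
  (forall i, (i < k)%N -> f i = f' i) -> meval g f p = meval g f' p.
Proof.
elim: k p => [|k IH] p eqf //=.
rewrite eqf // (_ : map_poly _ p = map_poly (@meval R S g f' k) p) //.
apply/polyP => i; rewrite /map_poly !coef_poly; case: ifP => // _.
by apply: IH => j lt_jk; apply: eqf; apply: ltnW.
Qed.

(** * Coefficients and degree bounds *)

Section Coefficients.
Variables (K : fieldType) (m : nat).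
Implicit Types (a b : expo m) (p q : mpoly K m).

Definition mcoef p a : K := Lam (fun c => (c == a)%:R) p.

Definition boxx d (c : {ffun 'I_m -> 'I_d.+1}) : expo m := [ffun i => val (c i)].

(* Degree at most d in each variable. *)
Definition bdeg d p :=
  p = \sum_c mconst m (mcoef p (@boxx d c)) * monomial K (boxx c).

Lemma bdeg0 d : bdeg d 0.
Proof.
by rewrite /bdeg big1 // => c _; rewrite /mcoef Lam0 rmorph0 mul0r.
Qed.

Lemma bdegD d p q : bdeg d p -> bdeg d q -> bdeg d (p + q).
Proof.
rewrite /bdeg => Hp Hq; rewrite {1}Hp {1}Hq -big_split /=; apply: eq_bigr => c _.
by rewrite /mcoef LamD rmorphD mulrDl.
Qed.

Lemma bdegZ d x p : bdeg d p -> bdeg d (mconst m x * p).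
Proof.
rewrite /bdeg => Hp; rewrite {1}Hp mulr_sumr; apply: eq_bigr => c _.
by rewrite /mcoef Lam_const rmorphM mulrA.
Qed.

Lemma bdeg_sum d (I : Type) (r : seq I) (P : pred I) F :
  (forall i, P i -> bdeg d (F i)) -> bdeg d (\sum_(i <- r | P i) F i).
Proof. by move=> H; elim/big_ind: _ => //; [exact: bdeg0|exact: bdegD]. Qed.

Lemma bdeg_monomial d a : (forall i, a i <= d)%N -> bdeg d (monomial K a).
Proof.
move=> le_ad; pose c : {ffun 'I_m -> 'I_d.+1} := [ffun i => inord (a i)].
have ac : boxx c = a.
  by apply/ffunP => i; rewrite !ffunE /= inordK // ltnS le_ad.
rewrite /bdeg (bigD1 c) //= ac /mcoef Lam_monomial eqxx rmorph1 mul1r.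
rewrite big1 ?addr0 // => c' ne; rewrite Lam_monomial.
case: eqP => [eqa|_]; last by rewrite rmorph0 mul0r.
case/eqP: ne; apply/ffunP => i; apply: val_inj.
by rewrite -ac in eqa; have /ffunP/(_ i) := eqa; rewrite !ffunE.
Qed.

Lemma bdegW d d' p : (d <= d')%N -> bdeg d p -> bdeg d' p.
Proof.
move=> le_dd' ->; apply: bdeg_sum => c _; apply/bdegZ/bdeg_monomial => i.
by rewrite ffunE (leq_trans _ le_dd') // -ltnS ltn_ord.
Qed.

Lemma bdegM d d' p q : bdeg d p -> bdeg d' q -> bdeg (d + d') (p * q).
Proof.
move=> -> ->; rewrite mulr_suml; apply: bdeg_sum => c _.
rewrite mulr_sumr; apply: bdeg_sum => c' _.
rewrite mulrACA -rmorphM -monomialD; apply/bdegZ/bdeg_monomial => i.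
by rewrite !ffunE leq_add // -ltnS ltn_ord.
Qed.

Lemma bdeg1 : bdeg 0 (1 : mpoly K m).
Proof. by rewrite -monomial0; apply: bdeg_monomial => i; rewrite ffunE. Qed.

Lemma bdegX d p k : bdeg d p -> bdeg (k * d) (p ^+ k).
Proof.
move=> Hp; elim: k => [|k IH]; first exact: bdeg1.
by rewrite exprS mulSn; apply: bdegM.
Qed.

Lemma bdeg_ex p : exists d, bdeg d p.
Proof.
move: p; apply: monomial_span => [|p q [d Hp] [d' Hq]|c a].
- by exists 0%N; exact: bdeg0.
- exists (maxn d d'); apply: bdegD; [move: Hp | move: Hq]; apply: bdegW; lia.
- exists (\max_i a i); apply/bdegZ/bdeg_monomial => i.
  exact: (leq_bigmax i).
Qed.

Lemma mcoef_eq0 p : (forall a, mcoef p a = 0) -> p = 0.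
Proof.
move=> H; have [d ->] := bdeg_ex p; rewrite big1 // => c _.
by rewrite H rmorph0 mul0r.
Qed.

End Coefficients.

(** For a prime [P] this is algebraic independence of the classes of the first [t] values of [g] in
    the quotient by [P]; later values of [g] are irrelevant. *)
Definition indep_mod (K : fieldType) m (P : mpoly K m -> Prop) t
    (g : nat -> mpoly K m) :=
  forall p : mpoly K t, P (meval (mconst m) g p) -> p = 0.

(** With [N] equal to the [m]-th power of [t * e + 1], the left side is at most [N * N.+1 ^ m],
    which is below [N.+1 ^ m.+1]. *)
Lemma bounded_power_gap (t m e : nat) : (m < t)%N ->
  exists N, ((t * (N * e)).+1 ^ m < N.+1 ^ t)%N.
Proof.
move=> lt_mt; exists ((t * e).+1 ^ m)%N; set N := ((t * e).+1 ^ m)%N.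
apply: (@leq_ltn_trans (N * N.+1 ^ m)).
  have [->|m_gt0] := posnP m; first by rewrite !expn0 muln1 /N expn_gt0.
  rewrite {2}/N -expnMn leq_exp2r //; nia.
apply: (@leq_trans (N.+1 ^ m.+1)); last by rewrite leq_pexp2l.
by rewrite expnS ltn_pmul2r // expn_gt0.
Qed.

(** If [t] exceeded [m], the power products of the [g i] with exponents up to [N] would outnumber
    the monomials in the box of side [M] that contains them all, and a linear dependence among them
    would be an algebraic relation. *)
Lemma indep_mod0_le (K : fieldType) m t (g : nat -> mpoly K m) :
  indep_mod (fun p => p = 0) t g -> (t <= m)%N.
Proof.
move=> ind; rewrite leqNgt; apply/negP => lt_mt.
have [e He] : exists e, forall i : 'I_t, bdeg e (g i).
  have [e He] := fin_all_exists (fun i : 'I_t => bdeg_ex (g i)).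
  exists (\max_i e i) => i; apply: bdegW (He i); exact: (leq_bigmax i).
have [N HN] := bounded_power_gap e lt_mt.
set M := (t * (N * e))%N in HN.
pose C := \matrix_(i < #|{ffun 'I_t -> 'I_N.+1}|, j < #|{ffun 'I_m -> 'I_M.+1}|)
  mcoef (meval (mconst m) g (monomial K (boxx (enum_val i)))) (boxx (enum_val j)).
have : kermx C != 0.
  rewrite kermx_eq0 /row_free; apply/eqP => rkC.
  by have := rank_leq_col C; rewrite rkC !card_ffun !card_ord leqNgt HN.
case/rowV0Pn => v /sub_kermxP vC nz_v.
pose p := \sum_i mconst t (v 0 i) * monomial K (@boxx t N (enum_val i)).
have p0 : p = 0.
  apply: ind.
  have Hb : bdeg M (meval (mconst m) g p).
    rewrite raddf_sum /=; apply: bdeg_sum => i _.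
    rewrite rmorphM /= meval_const; apply: bdegZ.
    rewrite rmorph_prod /= /M -[X in (X * _)%N]card_ord -sum_nat_const.
    elim/big_ind2: _ => [|p1 d1 p2 d2|j _]; first exact: bdeg1.
      exact: bdegM.
    rewrite rmorphXn /= meval_var //; apply: bdegW (bdegX _ (He j)).
    by rewrite leq_mul2r ffunE -ltnS ltn_ord orbT.
  rewrite Hb big1 // => c _.
  suff -> : mcoef (meval (mconst m) g p) (boxx c) = (v *m C) 0 (enum_rank c).
    by rewrite vC mxE rmorph0 mul0r.
  rewrite raddf_sum /= /mcoef Lam_sum mxE; apply: eq_bigr => i _.
  by rewrite rmorphM /= meval_const Lam_const !mxE enum_rankK.
(* The rows index distinct monomials, so each entry of [v] is a coefficient of [p] and vanishes with
   it. *)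
case/eqP: nz_v; apply/rowP => i; rewrite mxE.
have := congr1 (fun q => mcoef q (boxx (enum_val i))) p0.
rewrite /mcoef Lam0 Lam_sum (bigD1 i) //= Lam_const Lam_monomial eqxx mulr1.
rewrite big1 ?addr0 // => j ne_ji; rewrite Lam_const Lam_monomial.
case: eqP => [eqb|_]; last by rewrite mulr0.
case/eqP: ne_ji; apply: enum_val_inj; apply/ffunP => k; apply: val_inj.
by have /ffunP/(_ k) := eqb; rewrite !ffunE.
Qed.

(** Write a relation modulo [P] as [q * 'X + c] in the new variable. Modulo [Q] the element [y]
    disappears, so [c] is a relation modulo [Q] and is zero. Primality of [P] then cancels [y], and
    [q] is a relation handled by induction. *)
Lemma indep_mod_extend (K : fieldType) m (P Q : mpoly K m -> Prop) t g y :
  is_prime_ideal P -> is_ideal Q -> (forall x, P x -> Q x) -> Q y -> ~ P y ->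
  indep_mod Q t g ->
  indep_mod P t.+1 (fun i => if i == t then y else g i).
Proof.
move=> [Pid _ Pprime] [_ QD QM] PQ Qy nPy ind.
set g' := fun i => _.
have eqg (c : mpoly K t) : meval (mconst m) g' c = meval (mconst m) g c.
  by apply: eq_meval => i lt_it; rewrite /g' (ltn_eqF lt_it).
have ev (q : {poly mpoly K t}) (c : mpoly K t) :
  meval (mconst m) g' (q * 'X + c%:P : mpoly K t.+1) =
  meval (mconst m) g' (q : mpoly K t.+1) * y + meval (mconst m) g c.
  rewrite /= rmorphD rmorphM /= map_polyC map_polyX !hornerE /= eqg.
  by rewrite /g' eqxx.
move=> p; elim/poly_ind: (p : {poly mpoly K t}) => // q c IH.
rewrite ev => Pqc.
have c0 : c = 0.
  apply: ind; set q' := meval _ g' _ in Pqc.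
  rewrite -(addrK (q' * y) (meval _ _ _)) addrC [_ + q' * y]addrC -mulNr.
  by apply: QD; [exact: QM | exact: PQ].
move: Pqc; rewrite c0 raddf0 addr0 => /Pprime [/IH -> | //].
by rewrite mul0r add0r.
Qed.

(** The chain is descended from its top [P], and each strict inclusion adds one independent
    element. *)
Lemma chain_indep (K : fieldType) m (P : mpoly K m -> Prop) t g l :
  indep_mod P t g -> prime_chain_to P l -> (t + l <= m)%N.
Proof.
move=> ind [c [prc incl eqP]].
have : forall j, (j <= l)%N -> exists g', indep_mod (c (l - j)%N) (t + j) g'.
  elim=> [_|j IH lt_jl].
    by rewrite subn0 addn0; exists g => p /eqP; exact: ind.
  have [g' ind'] := IH (ltnW lt_jl).
  have lt : (l - j.+1 < l)%N by lia.
  have [sub [y [Qy nPy]]] := incl _ lt.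
  rewrite subnSK // in sub Qy.
  have prP := prc _ (ltnW lt); have [Qid _ _] := prc _ (leq_subr j l).
  by rewrite addnS; eexists; apply: indep_mod_extend prP Qid sub Qy nPy ind'.
case/(_ l (leqnn l)); rewrite subnn => g' ind'.
(* The bottom prime contains zero, so independence modulo it implies plain algebraic
   independence. *)
apply: (@indep_mod0_le K m (t + l) g') => p p0; apply: ind'; rewrite p0.
by have [[]] := prc 0%N isT.
Qed.

(** * Height of the toric ideal and rank of the incidence matrix *)

Section ToricHeight.
Variables (K : fieldType) (n m : nat) (E : 'I_m -> 'I_n * 'I_n).

Definition incmx : 'M[rat]_(m, n) := \matrix_(e, x) (inc E e x)%:R.

(** Take the variables of edges whose incidence rows form a row basis. Linear independence of these
    rows makes distinct monomials in them have distinct images, so no polynomial relation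
    survives. *)
Lemma toric_indep :
  exists g, indep_mod (toric_ideal K E) (\rank incmx) g.
Proof.
set r := \rank _; pose s : 'I_r -> 'I_m := maxrankfun incmx.
pose g i := if insub i is Some j then mvar K m (s j) else 0.
pose push (a : expo r) : expo m := [ffun e => \sum_i a i * (s i == e)]%N.
have push_inj (a b : expo r) : vdeg E (push a) = vdeg E (push b) -> a = b.
  move=> eqab.
  have rowE (c : expo r) : (\row_i (c i)%:R) *m rowsub s incmx
                           = \row_x (vdeg E (push c) x)%:R.
    apply/rowP => x; rewrite !mxE ffunE.
    under [in RHS]eq_bigr => e _ do rewrite ffunE big_distrl.
    rewrite exchange_big natr_sum; apply: eq_bigr => i _ /=; rewrite !mxE.
    rewrite (bigD1 (s i)) //= eqxx muln1 big1 ?addn0 ?natrM //.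
    by move=> e; rewrite eq_sym => /negPf ->; rewrite muln0.
  have := rowE a; rewrite eqab -rowE => /(row_free_inj (maxrowsub_free _)) H.
  apply/ffunP => i; have /rowP/(_ i) := H; rewrite !mxE => /eqP.
  by rewrite eqr_nat => /eqP.
exists g => p.
(* The coefficient of [a] in [p] reappears unchanged in the image, at the exponent
   [vdeg E (push a)]. *)
have coefp a : mcoef (edge_map E (meval (mconst m) g p)) (vdeg E (push a)) = mcoef p a.
  move: p; apply: monomial_span => [|p q Hp Hq|c b].
  - by rewrite edge_mapE !raddf0 /mcoef !Lam0.
  - by rewrite edge_mapE !raddfD /= -!edge_mapE /mcoef !LamD; congr (_ + _).
  rewrite edge_mapE !rmorphM /= !meval_const /mcoef !Lam_const -edge_mapE.
  rewrite Lam_monomial; congr (_ * _).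
  have -> : meval (mconst m) g (monomial K b) = monomial K (push b).
    rewrite rmorph_prod /=.
    have -> : monomial K (push b) =
        \prod_(e < m) \prod_(i < r) mvar K m e ^+ (b i * (s i == e)).
      by apply: eq_bigr => e _; rewrite prodrXr ffunE.
    rewrite exchange_big; apply: eq_bigr => i _ /=.
    rewrite rmorphXn /= meval_var // /g valK.
    rewrite (bigD1 (s i)) //= eqxx muln1 big1 ?mulr1 //.
    by move=> e; rewrite eq_sym => /negPf ->; rewrite muln0.
  rewrite edge_map_monomial Lam_monomial; congr (_%:R); congr nat_of_bool.
  by apply/eqP/eqP => [/push_inj|->].
rewrite /toric_ideal => p0; apply: mcoef_eq0 => a.
by rewrite -coefp p0 /mcoef Lam0.
Qed.

(** The ideal is prime, hence itself a candidate in the minimum defining its height, as soon as the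
    lengths of its chains have a maximum; [chain_indep] bounds them. *)
Lemma toric_height_le h : ideal_height (toric_ideal K E) h ->
  (\rank incmx + h <= m)%N.
Proof.
move=> [_ Hmin]; have [g ind] := toric_indep.
have prI := toric_prime K E.
have bnd l : prime_chain_to (toric_ideal K E) l -> (\rank incmx + l <= m)%N.
  exact: chain_indep ind.
apply: NNPP => Hh.
(* A chain length that cannot be raised by one would be the prime height, so [h <= l], and the bound
   on [l] would pass to [h]. *)
have step l : prime_chain_to (toric_ideal K E) l ->
              prime_chain_to (toric_ideal K E) l.+1.
  move=> Hl; apply: NNPP => nHl; apply: Hh.
  have le_hl : (h <= l)%N by apply: Hmin prI _ (conj Hl nHl).
  by apply: leq_trans (bnd _ Hl); rewrite leq_add2l.
have all_l l : prime_chain_to (toric_ideal K E) l.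
  elim: l => [|l]; last exact: step.
  by exists (fun=> toric_ideal K E); split=> // i.
by have := bnd _ (all_l m.+1); lia.
Qed.

End ToricHeight.

(** * Minimal binomial generating systems *)

Lemma InP (T : eqType) (x : T) (s : seq T) : List.In x s <-> x \in s.
Proof.
elim: s => //= y s IH; rewrite inE; split.
  by case=> [->|/IH ->]; rewrite ?eqxx ?orbT.
by case/orP => [/eqP ->|/IH]; [left | right].
Qed.

Section GeneratedIdeals.
Variable A : comNzRingType.
Implicit Types (S : A -> Prop) (p q x : A).

Lemma gen0 S : in_ideal_gen S 0.
Proof. by exists [::]; split=> //; rewrite big_nil. Qed.

Lemma gen_mem S x : S x -> in_ideal_gen S x.
Proof.
move=> Sx; exists [:: (1, x)]; split=> [y [<- //|[]]|].
by rewrite big_seq1 mul1r.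
Qed.

Lemma genD S p q : in_ideal_gen S p -> in_ideal_gen S q -> in_ideal_gen S (p + q).
Proof.
move=> [l [Hl ->]] [l' [Hl' ->]]; exists (l ++ l'); rewrite big_cat; split=> // x.
by rewrite List.in_app_iff => -[/Hl|/Hl'].
Qed.

Lemma genM S c p : in_ideal_gen S p -> in_ideal_gen S (c * p).
Proof.
move=> [l [Hl ->]]; exists [seq (c * y.1, y.2) | y <- l]; split=> [y|].
  by move=> /List.in_map_iff [z [<- /Hl]].
by rewrite big_map mulr_sumr; apply: eq_bigr => x _; rewrite mulrA.
Qed.

Lemma genN S p : in_ideal_gen S p -> in_ideal_gen S (- p).
Proof. by move=> Hp; rewrite -mulN1r; apply: genM. Qed.

Lemma gen_ind S (Q : A -> Prop) :
  Q 0 -> (forall p q, Q p -> Q q -> Q (p + q)) ->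
  (forall c x, S x -> Q (c * x)) -> forall p, in_ideal_gen S p -> Q p.
Proof.
move=> Q0 QD QM p [l [Hl ->]]; elim: l Hl => [|y l IH] Hl; first by rewrite big_nil.
rewrite big_cons; apply: QD; first by apply/QM/Hl; left.
by apply: IH => x lx; apply: Hl; right.
Qed.

Lemma gen_trans S S' p :
  (forall x, S x -> in_ideal_gen S' x) -> in_ideal_gen S p -> in_ideal_gen S' p.
Proof.
by move=> SS'; apply: gen_ind => [|q r|c x /SS']; [exact: gen0|exact: genD|exact: genM].
Qed.

Lemma gen_seq (s : seq A) p : in_ideal_gen (fun x => x \in s) p ->
  exists c : 'I_(size s) -> A, p = \sum_i c i * s`_i.
Proof.
move: p; apply: gen_ind => [|p q [c ->] [d ->]|c x /(nthP 0)[i lt_i <-]].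
- by exists (fun=> 0); rewrite big1 // => i _; rewrite mul0r.
- exists (fun i => c i + d i); rewrite -big_split.
  by apply: eq_bigr => i _; rewrite mulrDl.
exists (fun j => if j == Ordinal lt_i then c else 0).
rewrite (bigD1 (Ordinal lt_i)) //= eqxx big1 ?addr0 // => j /negPf ->.
by rewrite mul0r.
Qed.

(** Each of the finitely many expressions involves finitely many elements of [S]; [T] collects
    them. *)
Lemma gen_finite S (gs : seq A) : (forall g, g \in gs -> in_ideal_gen S g) ->
  exists2 T : seq A, (forall x, x \in T -> S x) &
    forall g, g \in gs -> in_ideal_gen (fun x => x \in T) g.
Proof.
elim: gs => [|g gs IH] Hgs; first by exists [::].
have [|T TS HT] := IH; first by move=> x gx; apply: Hgs; rewrite inE gx orbT.
have [l [Hl eqg]] := Hgs g (mem_head _ _).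
exists ([seq y.2 | y <- l] ++ T) => x.
  by rewrite mem_cat => /orP[/mapP[y /InP/Hl Sy ->]|/TS].
rewrite inE => /orP[/eqP ->|/HT]; last first.
  by apply: gen_trans => y Ty; apply: gen_mem; rewrite mem_cat Ty orbT.
exists l; split=> // y /InP ly.
by rewrite mem_cat map_f.
Qed.

End GeneratedIdeals.

Section MinimalSystem.
Variables (K : fieldType) (n m : nat) (E : 'I_m -> 'I_n * 'I_n).
Variable S : mpoly K m -> Prop.
Hypothesis minS : minimal_binomial_gen_system (toric_ideal K E) S.

Lemma toric_mem f : S f -> toric_ideal K E f.
Proof. by have [_ genS _] := minS => Sf; apply/genS/gen_mem. Qed.

Lemma min_not_gen f : S f -> ~ in_ideal_gen (fun p => S p /\ p <> f) f.
Proof.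
have [_ genS minimal] := minS => Sf fS'.
have [] // := minimal (fun p => S p /\ p <> f) _ _ f Sf; first by move=> p [].
move=> p; rewrite genS; split; apply: gen_trans => x; last by move=> [Sx _]; apply: gen_mem.
by move=> Sx; case: (eqVneq x f) => [-> // | /eqP ne]; apply: gen_mem.
Qed.

(* The weight is the indicator of the monomials congruent to x^u modulo the
   ideal generated by the other elements of S. *)
Lemma min_functional f (u v : expo m) : S f -> f = monomial K u - monomial K v ->
  exists w : expo m -> K,
    (forall g f', S f' -> f' <> f -> Lam w (g * f') = 0) /\
    (forall g, Lam w (g * f) = eval0 g).
Proof.
move=> Sf eqf; have [binS genS _] := minS; have nfS' := min_not_gen Sf.
pose S' p := S p /\ p <> f.
pose P (a : expo m) := in_ideal_gen S' (monomial K u - monomial K a).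
pose w a : K := if excluded_middle_informative (P a) then 1 else 0.
have wE a b : (P a <-> P b) -> w a = w b.
  case=> ab ba; rewrite /w.
  case: excluded_middle_informative => Pa; case: excluded_middle_informative => Pb //.
    by case: (Pb (ab Pa)).
  by case: (Pa (ba Pb)).
have vuv : vdeg E u = vdeg E v by apply/(toric_binomial K); rewrite -eqf; apply: toric_mem.
have degP a : P a -> vdeg E u = vdeg E a.
  move=> Pa; apply/(toric_binomial K)/genS; apply: gen_trans Pa => x [Sx _].
  exact: gen_mem.
exists w; split=> [g f' Sf' nef|g].
  have [u' [v' eqf']] := is_binomialP (binS _ Sf').
  move: g; apply: monomial_span => [|p q Hp Hq|c b].
  - by rewrite mul0r Lam0.
  - by rewrite mulrDl LamD Hp Hq addr0.
  rewrite -mulrA Lam_const eqf' mulrBr -!monomialD LamB !Lam_monomial.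
  rewrite (wE (addx b u') (addx b v')) ?subrr ?mulr0 // /P !monomialD.
  have D : in_ideal_gen S' (monomial K b * (monomial K u' - monomial K v')).
    by apply/genM/gen_mem; rewrite -eqf'.
  split=> H; first by have := genD H D; rewrite mulrBr addrA subrK.
  by have := genD H (genN D); rewrite mulrBr opprB addrA subrK.
move: g; apply: monomial_span => [|p q Hp Hq|c b].
- by rewrite mul0r Lam0 /eval0 raddf0.
- by rewrite mulrDl LamD Hp Hq /eval0 raddfD.
rewrite -mulrA Lam_const /eval0 rmorphM /= meval_const -/(eval0 _) eval0_monomial.
congr (_ * _); rewrite eqf mulrBr -!monomialD LamB !Lam_monomial.
(* For [b] zero the value is 1 - 0: a congruence between [u] and [v] would put [f] in the ideal of
   the other generators. *)
case: eqP => [->|nzb]; rewrite ?add0x.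
  rewrite /w; case: excluded_middle_informative => Pu; last first.
    by case: Pu; rewrite /P subrr; apply: gen0.
  case: excluded_middle_informative => Pv; last by rewrite subr0.
  by case: nfS'; rewrite {2}eqf.
(* For [b] nonzero the degree strictly exceeds that of [u], whereas congruent monomials have equal
   degree. *)
have nP a : vdeg E a = vdeg E u -> w (addx b a) = 0.
  move=> eqa; rewrite /w; case: excluded_middle_informative => // Pa.
  move: (degP _ Pa); rewrite vdegD eqa => H; case: nzb; apply: (@vdeg_eq0 _ _ E); apply/ffunP => x.
  by have /ffunP/(_ x) := H; rewrite !ffunE; lia.
by rewrite !nP ?subrr.
Qed.

(** So [f] is not in the product of the maximal ideal and the toric ideal. When [p] is expanded in
    [S], the coefficients of [f] in [g * p] have no constant term, which is all that the functional
    detects. *)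
Lemma min_not_maximal_mul f (u v : expo m) : S f -> f = monomial K u - monomial K v ->
  exists w : expo m -> K, Lam w f = 1 /\
    forall g p, eval0 g = 0 -> toric_ideal K E p -> Lam w (g * p) = 0.
Proof.
move=> Sf eqf; have [w [w0 wf]] := min_functional Sf eqf; have [_ genS _] := minS.
exists w; split; first by rewrite -[f]mul1r wf /eval0 rmorph1.
move=> g p g0 /genS; move: p; apply: gen_ind => [|p q Hp Hq|c x Sx].
- by rewrite mulr0 Lam0.
- by rewrite mulrDr LamD Hp Hq addr0.
rewrite mulrA; case: (eqVneq x f) => [->|/eqP ne]; last exact: w0.
by rewrite wf /eval0 rmorphM /= -!/(eval0 _) g0 mul0r.
Qed.

(** The Nakayama argument: express [T] through [gs] and [gs] through [T]. Modulo the maximal ideal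
    the two coefficient matrices multiply to the identity, so the rank is bounded by [size gs]. *)
Lemma min_system_bound (gs : seq (mpoly K m)) :
  generates (fun p => List.In p gs) (toric_ideal K E) ->
  exists T : seq (mpoly K m),
    [/\ uniq T, (forall p, S p <-> p \in T) & (size T <= size gs)%N].
Proof.
move=> gengs; have [binS genS minimal] := minS.
have InE s x := @InP (mpoly K m) x s.
have [|T0 T0S genT0] := @gen_finite _ S gs.
  by move=> g /InE gsg; apply/genS/gengs/gen_mem.
(* A finite part of [S] already generates [gs], hence the ideal, so minimality makes it all of
   [S]. *)
have ST p : S p <-> p \in undup T0.
  rewrite mem_undup; split; last exact: T0S.
  move: p; apply: (minimal (fun x => x \in T0)) => // p; split=> [/gengs|].
    by apply: gen_trans => x /InE/genT0.
  by move=> Hp; apply/genS; apply: gen_trans Hp => x /T0S; apply: gen_mem.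
exists (undup T0); split=> //; first exact: undup_uniq.
move: (undup T0) (undup_uniq T0) ST => T uT ST.
have gsT (k : 'I_(size gs)) : exists b : 'I_(size T) -> mpoly K m,
    gs`_k = \sum_j b j * T`_j.
  apply: gen_seq; have /gengs/genS : in_ideal_gen (fun p => List.In p gs) gs`_k.
    by apply/gen_mem/InE/mem_nth.
  by apply: gen_trans => x /ST Tx; apply: gen_mem.
have Tgs (i : 'I_(size T)) : exists a : 'I_(size gs) -> mpoly K m,
    T`_i = \sum_k a k * gs`_k.
  apply: gen_seq; have /ST/toric_mem/gengs := mem_nth 0 (ltn_ord i).
  by apply: gen_trans => x /InE gx; apply: gen_mem.
have [b Hb] := fin_all_exists gsT; have [a Ha] := fin_all_exists Tgs.
(* The functional dual to the [j]-th element: it returns the constant term of that element's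
   coefficient and ignores the others. *)
have Tfun (j : 'I_(size T)) : exists w : expo m -> K,
    forall g (k : 'I_(size T)), Lam w (g * T`_k) = eval0 g * (j == k)%:R.
  have STi (k : 'I_(size T)) : S T`_k by apply/ST/mem_nth.
  have [u [v]] := is_binomialP (binS _ (STi j)).
  move=> /(min_functional (STi j)) [w [w0 wf]]; exists w => g k.
  case: (eqVneq j k) => [<-|ne_jk]; first by rewrite wf mulr1.
  rewrite mulr0 w0 //.
  by move/eqP; rewrite nth_uniq // eq_sym => /eqP/val_inj/eqP; rewrite (negPf ne_jk).
pose MA := \matrix_(i < size T, k < size gs) eval0 (a i k).
pose MB := \matrix_(k < size gs, j < size T) eval0 (b k j).
have AB : MA *m MB = 1%:M.
  apply/matrixP => i j; have [w Hw] := Tfun j.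
  rewrite !mxE; transitivity (Lam w T`_i); last first.
    by rewrite -[T`_i]mul1r Hw /eval0 rmorph1 mul1r eq_sym.
  rewrite Ha Lam_sum; apply: eq_bigr => k _; rewrite !mxE Hb mulr_sumr Lam_sum.
  rewrite (bigD1 j) //= mulrA Hw eqxx mulr1 big1 ?addr0 => [|l ne_lj].
    by rewrite /eval0 rmorphM.
  by rewrite mulrA Hw eq_sym (negPf ne_lj) mulr0.
rewrite -[X in (X <= _)%N](@mxrank1 K) -AB (leq_trans (mxrankM_maxl _ _)) //.
exact: rank_leq_col.
Qed.
End MinimalSystem.

(** * Even cycles and alternating walks *)

Section CycleExponents.
Variables (K : fieldType) (n m : nat) (E : 'I_m -> 'I_n * 'I_n).

Lemma even_cycle_edge q (vs : 'I_(q.*2) -> 'I_n) (es : 'I_(q.*2) -> 'I_m) k :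
  even_cycle E vs es ->
  (E (es k) == (vs k, vs (ordS k))) || (E (es k) == (vs (ordS k), vs k)).
Proof.
move=> [_ [_ /(_ k) [Hk]]].
by have -> : Ordinal Hk = ordS k by apply: val_inj.
Qed.

(* Exponents of the two monomials of B_w: c selects the odd positions. *)
Definition cycx q (es : 'I_(q.*2) -> 'I_m) (c : bool) : expo m :=
  [ffun e => \sum_(k < q.*2 | odd k == c) (es k == e)]%N.

Lemma prod_mvar (I : finType) (P : pred I) (es : I -> 'I_m) :
  \prod_(k | P k) mvar K m (es k) =
  monomial K [ffun e : 'I_m => \sum_(k | P k) (es k == e)]%N.
Proof.
transitivity (\prod_(e < m) \prod_(k | P k) mvar K m e ^+ (es k == e)).
  rewrite exchange_big; apply: eq_bigr => k _ /=.
  rewrite (bigD1 (es k)) //= eqxx expr1 big1 ?mulr1 // => e.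
  by rewrite eq_sym => /negPf ->.
by apply: eq_bigr => e _; rewrite prodrXr ffunE.
Qed.

Lemma B_wE q (es : 'I_(q.*2) -> 'I_m) :
  B_w K es = monomial K (cycx es false) - monomial K (cycx es true).
Proof.
rewrite /B_w; congr (_ - _); rewrite prod_mvar; apply: eq_bigr => e _;
  rewrite !ffunE; congr (_ ^+ _); apply: eq_bigl => k.
  by rewrite eqbF_neg.
by rewrite eqb_id.
Qed.

(** The edges in positions of one parity form a perfect matching of the cycle's vertices, so either
    parity gives the same degree. *)
Lemma vdeg_cycx q (vs : 'I_(q.*2) -> 'I_n) (es : 'I_(q.*2) -> 'I_m) c x :
  even_cycle E vs es ->
  vdeg E (cycx es c) x = (\sum_(k < q.*2) (vs k == x))%N.
Proof.
move=> cyc; rewrite ffunE.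
under eq_bigr => e _ do rewrite ffunE big_distrl.
rewrite exchange_big /=.
transitivity (\sum_(k < q.*2 | odd k == c) ((vs k == x) + (vs (ordS k) == x)))%N.
  apply: eq_bigr => k _.
  rewrite (bigD1 (es k)) //= eqxx mul1n big1 ?addn0 => [|e].
    rewrite /inc; case/orP: (even_cycle_edge k cyc) => /eqP -> //=.
    by rewrite addnC.
  by rewrite eq_sym => /negPf ->.
rewrite big_split /= [RHS](bigID (fun k : 'I_(q.*2) => odd k == c)) /=.
(* The cyclic successor flips parity, including the wrap from the last index, which is odd, to
   zero. *)
congr (_ + _)%N; rewrite [RHS](reindex_inj (@ordS_inj _)).
apply: eq_bigl => k /=.
have [lt|ge] := ltnP k.+1 q.*2; first by rewrite modn_small //=; case: (odd k); case: c.
have -> : k.+1 = q.*2 by have := ltn_ord k; lia.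
rewrite modnn /=.
have : odd k by have := odd_double q; have := ltn_ord k; lia.
by move=> ->; case: c.
Qed.

Lemma vdeg_cycx_le1 q (vs : 'I_(q.*2) -> 'I_n) (es : 'I_(q.*2) -> 'I_m) c x :
  even_cycle E vs es -> (vdeg E (cycx es c) x <= 1)%N.
Proof.
move=> cyc; rewrite (vdeg_cycx _ _ cyc); have [_ [inj _]] := cyc.
case: (pickP (fun k => vs k == x)) => [k /eqP vk|no]; last first.
  by rewrite big1 // => k _; rewrite no.
rewrite (bigD1 k) //= vk eqxx big1 // => k' ne; apply/eqP; rewrite eqb0.
by apply: contraNneq ne => vk'; apply/eqP/inj; rewrite vk vk'.
Qed.

Lemma cycx_le1 q (vs : 'I_(q.*2) -> 'I_n) (es : 'I_(q.*2) -> 'I_m) c e :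
  even_cycle E vs es -> (cycx es c e <= 1)%N.
Proof.
move=> /(vdeg_cycx_le1 c (E e).1); apply: leq_trans.
by rewrite [vdeg _ _ _]ffunE (bigD1 e) //= {1}/inc eqxx; nia.
Qed.

Lemma cycx_nz q (vs : 'I_(q.*2) -> 'I_n) (es : 'I_(q.*2) -> 'I_m) c :
  even_cycle E vs es -> cycx es c != zerox m.
Proof.
move=> cyc; have [q2 _] := cyc; have q0 : (0 < q.*2)%N by lia.
apply/eqP => c0; have := vdeg_cycx c (vs (Ordinal q0)) cyc.
rewrite c0 ffunE big1 => [|e _]; last by rewrite ffunE.
by rewrite (bigD1 (Ordinal q0)) //= eqxx.
Qed.

Lemma toric_cycle q (vs : 'I_(q.*2) -> 'I_n) (es : 'I_(q.*2) -> 'I_m) :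
  even_cycle E vs es -> vdeg E (cycx es false) = vdeg E (cycx es true).
Proof. by move=> cyc; apply/ffunP => x; rewrite !(vdeg_cycx _ _ cyc). Qed.

End CycleExponents.

Lemma other_endpoint_uniq (T : Type) (x y z : T) (p : T * T) :
  p = (y, x) \/ p = (x, y) -> p = (x, z) \/ p = (z, x) -> y = z.
Proof. by case=> -> [] [] // -> ->. Qed.

(** * An even cycle in the union of two disjoint matchings *)

Section AlternatingWalk.
Variables (n m : nat) (E : 'I_m -> 'I_n * 'I_n) (u v : expo m).
Hypothesis simpleE : simple_edges E.
Hypothesis eq_deg : vdeg E u = vdeg E v.
Hypothesis deg_le1 : forall x, (vdeg E u x <= 1)%N.
Hypothesis disj : forall e, (0 < u e)%N -> (0 < v e)%N -> False.
Variable e0 : 'I_m.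
Hypothesis ue0 : (0 < u e0)%N.

Let w (t : bool) := if t then v else u.
Let sel t x := odflt e0 [pick e | (0 < w t e)%N && (0 < inc E e x)%N].
Let oth e x := if (E e).1 == x then (E e).2 else (E e).1.
(** A walk from an endpoint of [e0] that leaves by an edge of [u] at even times and of [v] at odd
    times. Every visited vertex has positive degree, so [sel] never falls back on its default
    [e0]. *)
Let Fixpoint b (k : nat) : 'I_n :=
  if k is k'.+1 then oth (sel (odd k') (b k')) (b k') else (E e0).1.
Let ed k := sel (odd k) (b k).

Let vdeg_w t x : vdeg E (w t) x = vdeg E u x.
Proof. by case: t; rewrite //= /w eq_deg. Qed.

Let inc_gt0 e x : (0 < inc E e x)%N = ((E e).1 == x) || ((E e).2 == x).
Proof. by rewrite /inc; case: eqP; case: eqP. Qed.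

Let wpos t e x : (0 < w t e)%N -> (0 < inc E e x)%N -> (0 < vdeg E u x)%N.
Proof.
by move=> we ie; rewrite -(vdeg_w t) ffunE (bigD1 e) //= addn_gt0 muln_gt0 we ie.
Qed.

Let selP t x : (0 < vdeg E u x)%N ->
  (0 < w t (sel t x))%N && (0 < inc E (sel t x) x)%N.
Proof.
rewrite -(vdeg_w t) ffunE /sel; case: pickP => //= no.
rewrite big1 // => e _; have := no e; case: (w t e) => //= k.
by case: (inc E e x) => //; rewrite muln0.
Qed.

Let othP e x : (0 < inc E e x)%N -> E e = (x, oth e x) \/ E e = (oth e x, x).
Proof.
rewrite inc_gt0 /oth; case: eqP => [<-|_] /=; first by left; case: (E e).
by move=> /eqP <-; right; case: (E e).
Qed.

Let b_pos k : (0 < vdeg E u (b k))%N.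
Proof.
elim: k => [|k IH]; first by apply: (@wpos false e0); rewrite // inc_gt0 eqxx.
have /andP[we ie] := selP (odd k) IH; apply: wpos we _ => /=.
by rewrite inc_gt0; case: (othP ie) => ->; rewrite eqxx ?orbT.
Qed.

Let edP k : (0 < w (odd k) (ed k))%N /\
  (E (ed k) = (b k, b k.+1) \/ E (ed k) = (b k.+1, b k)).
Proof. by have /andP[we ie] := selP (odd k) (b_pos k); split=> //; apply: othP. Qed.

Let no_loop k : b k != b k.+1.
Proof.
have [_ lt] := simpleE; have := lt (ed k).
by case: (edP k) => _ [] -> /=; rewrite ltn_neqAle => /andP[]; rewrite // eq_sym.
Qed.

(** Two distinct edges of the same kind at [x] would give it degree at least two. *)
Let same_edge t e e' x : (0 < w t e)%N -> (0 < w t e')%N ->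
  (0 < inc E e x)%N -> (0 < inc E e' x)%N -> e = e'.
Proof.
move=> we we' ie ie'; apply/eqP/negPn/negP => ne.
have := deg_le1 x; rewrite -(vdeg_w t) ffunE (bigD1 e) //= (bigD1 e') 1?eq_sym //=.
by nia.
Qed.

Let ed_inc k : (0 < inc E (ed k) (b k))%N /\ (0 < inc E (ed k) (b k.+1))%N.
Proof. by rewrite !inc_gt0; case: (edP k) => _ [] -> /=; rewrite !eqxx ?orbT. Qed.

(** The walk is cut at its first repeated vertex, [b i = b j]. The flag [t] is the parity of [i],
    which tells whether the even positions of the cycle lie in [u] or in [v]. *)
Lemma alternating_cycle :
  exists (q : nat) (vs : 'I_(q.*2) -> 'I_n) (es : 'I_(q.*2) -> 'I_m) (t : bool),
    even_cycle E vs es /\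
    forall c, lex (cycx es c) (if c (+) t then v else u).
Proof.
pose rep j := [exists i : 'I_j, b i == b j].
have exrep : exists j, rep j.
  apply: NNPP => no.
  have inj : injective (fun i : 'I_n.+1 => b i).
    have lem (i j : 'I_n.+1) : (i < j)%N -> b i <> b j.
      move=> lt_ij eqb; apply: no; exists j; apply/existsP.
      by exists (Ordinal lt_ij); apply/eqP.
    move=> i j eqb; apply: val_inj; case: (ltngtP i j) => // /lem; first by case.
    by case.
  by have := leq_card _ inj; rewrite !card_ord ltnn.
case: (ex_minnP exrep) => j /existsP[[i lt_ij] /= /eqP eqb] minj.
have binj k l : (k < j)%N -> (l < j)%N -> b k = b l -> k = l.
  have lem k' l' : (k' < l')%N -> (l' < j)%N -> b k' <> b l'.
    move=> lt lt' eqk; have := minj l'; rewrite leqNgt lt' => H.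
    by suff: false by []; apply/H/existsP; exists (Ordinal lt); apply/eqP.
  move=> ltk ltl eqk; case: (ltngtP k l) => // lt; first by case: (lem _ _ lt ltl).
  by case: (lem _ _ lt ltk).
have [j1 ej] : exists j1, j = j1.+1 by exists j.-1; lia.
(* With odd length, the edges at both ends of the segment would be of one kind and meet at [b i],
   hence coincide. Then [b j1 = b i.+1], which makes [i] and [j1] adjacent vertices equal or the
   length 2. *)
have ev : odd (j - i) = false.
  apply/negbTE/negP => oddL.
  have eqe : ed j1 = ed i.
    apply: (@same_edge (odd i) _ _ (b i)).
    - have -> : odd i = odd j1 by lia.
      by case: (edP j1).
    - by case: (edP i).
    - by rewrite eqb ej; case: (ed_inc j1).
    - by case: (ed_inc i).
  have eqv : b j1 = b i.+1.
    have [_ H1] := edP j1; have [_ H2] := edP i; rewrite eqe -ej -eqb in H1.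
    exact: other_endpoint_uniq H1 H2.
  have := no_loop j1; rewrite -ej -eqb.
  have [lt|ge] := ltnP i.+1 j; last first.
    have -> : j1 = i by lia.
    by rewrite eqxx.
  have := binj j1 i.+1; rewrite ej ltnSn -ej => /(_ isT lt eqv) ej1.
  by move: oddL; rewrite ej ej1 -addn2 addKn.
(* In length 2 both edges join the same vertices, so simplicity identifies them although one lies in
   [u] and the other in [v]. *)
have big : (2 < j - i)%N.
  rewrite ltnNge; apply/negP => le2.
  have ej2 : j = i.+2 by move: ev le2; case: (j - i)%N (subnKC (ltnW lt_ij)) => [|[|[|k]]] //=; lia.
  have eqe : ed i = ed i.+1.
    have [inj lt] := simpleE; apply: inj.
    have l1 := lt (ed i); have l2 := lt (ed i.+1).
    have [_ H1] := edP i; have [_ H2] := edP i.+1; rewrite -ej2 -eqb in H2.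
    move: l1 l2; case: H1 => ->; case: H2 => -> //=; lia.
  have [H1 _] := edP i; have [H2 _] := edP i.+1; rewrite -eqe /= in H2.
  by move: H1 H2; rewrite /w; case: (odd i) => /= A B; apply: (@disj (ed i)).
pose q := (j - i)./2.
have eq2 : q.*2 = (j - i)%N by rewrite /q -[RHS]odd_double_half ev.
pose vs (k : 'I_(q.*2)) := b (i + k).
pose es (k : 'I_(q.*2)) := ed (i + k).
have cyc : even_cycle E vs es.
  split; first by lia.
  split=> [k l|k].
    have := ltn_ord k; have := ltn_ord l; rewrite [X in (_ < X)%N -> _]eq2.
    rewrite [X in _ -> (_ < X)%N -> _]eq2 => lt_l lt_k /binj H; apply: val_inj.
    by apply: (@addnI i); apply: H; lia.
  have lt' : (k.+1 %% q.*2 < q.*2)%N by rewrite ltn_mod; lia.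
  exists lt'.
  have -> : vs (Ordinal lt') = b (i + k).+1.
    rewrite -[vs _]/(b (i + k.+1 %% q.*2)).
    have [lt|ge] := ltnP k.+1 q.*2; first by rewrite modn_small // addnS.
    have ek : k.+1 = q.*2 by have := ltn_ord k; lia.
    rewrite ek modnn addn0 eqb -addnS ek; congr b; lia.
  by case: (edP (i + k)) => _ [] ->; rewrite eqxx ?orbT.
exists q, vs, es, (odd i); split=> // c; apply/forallP => e.
have := cycx_le1 c e cyc; case E1 : (cycx es c e) => [//|k] le1.
apply: (leq_trans le1).
have : cycx es c e != 0%N by rewrite E1.
rewrite ffunE sum_nat_eq0 negb_forall => /existsP[l].
rewrite negb_imply => /andP[/eqP ol]; rewrite eqb0 negbK => /eqP <-.
have [] := edP (i + l); rewrite oddD ol addbC /w.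
by case: (c (+) odd i).
Qed.

End AlternatingWalk.

(** * Primitivity of minimal generators *)

Section MinimalCycles.
Variables (K : fieldType) (n m : nat) (E : 'I_m -> 'I_n * 'I_n).
Variable S : mpoly K m -> Prop.
Hypothesis simpleE : simple_edges E.
Hypothesis minS : minimal_binomial_gen_system (toric_ideal K E) S.
Variables (f : mpoly K m) (u v : expo m).
Hypotheses (Sf : S f) (eqf : f = monomial K u - monomial K v).

Lemma min_vdeg : vdeg E u = vdeg E v.
Proof. by apply/(toric_binomial K); rewrite -eqf; apply: toric_mem minS _ Sf. Qed.

(** Otherwise splitting off [a] and [b] writes [f] with coefficients without constant term over the
    toric ideal, contrary to [min_not_maximal_mul]. *)
Lemma min_primitive (a b : expo m) : lex a u -> lex b v ->
  vdeg E a = vdeg E b -> a != zerox m -> a = u /\ b = v.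
Proof.
move=> au bv eqd nza.
have eqd' : vdeg E (subx u a) = vdeg E (subx v b).
  by apply: (@addxI _ (vdeg E a)); rewrite {2}eqd -!vdegD !subxK // min_vdeg.
have nzb : b != zerox m.
  apply: contraNneq nza => b0; apply/eqP; apply: (@vdeg_eq0 _ _ E); rewrite eqd b0.
  by apply/ffunP => x; rewrite !ffunE big1 // => e _; rewrite ffunE.
have [w [w1 w0]] := min_not_maximal_mul minS Sf eqf.
have /eqP ua0 : subx u a == zerox m.
  apply/negPn/negP => nz.
  have ef : f = monomial K (subx u a) * (monomial K a - monomial K b)
     + monomial K b * (monomial K (subx u a) - monomial K (subx v b)).
    rewrite eqf -{1}(subxK au) -{1}(subxK bv) !monomialD; ring.
  move: w1; rewrite ef LamD !w0 ?eval0_monomial ?(negPf nz) ?(negPf nzb) ?addr0 //.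
  - by move/eqP; rewrite eq_sym oner_eq0.
  - exact/toric_binomial.
  - exact/toric_binomial.
have vb0 : subx v b = zerox m.
  apply: (@vdeg_eq0 _ _ E); rewrite -eqd' ua0.
  by apply/ffunP => x; rewrite !ffunE big1 // => e _; rewrite ffunE.
by rewrite -(subxK au) -(subxK bv) ua0 vb0 !add0x.
Qed.

(** An edge common to [u] and [v] would by primitivity exhaust both, so these are disjoint
    matchings. They contain an alternating cycle, and primitivity makes it all of [f]. *)
Lemma min_le1_even_cycle : (forall x, (vdeg E u x <= 1)%N) ->
  exists (q : nat) (vs : 'I_(q.*2) -> 'I_n) (es : 'I_(q.*2) -> 'I_m),
    even_cycle E vs es /\ (f = B_w K es \/ f = - B_w K es).
Proof.
move=> le1.
have [w [w1 _]] := min_not_maximal_mul minS Sf eqf.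
have ne_uv : u <> v.
  move=> uv; move: w1; rewrite eqf uv subrr Lam0 => /eqP.
  by rewrite eq_sym oner_eq0.
have disj e : (0 < u e)%N -> (0 < v e)%N -> False.
  move=> ue ve; pose d : expo m := [ffun i => (i == e) : nat].
  have [||//||du dv] := @min_primitive d d.
  - by apply/forallP => i; rewrite ffunE; case: eqP => // ->.
  - by apply/forallP => i; rewrite ffunE; case: eqP => // ->.
  - by apply/eqP => /ffunP/(_ e); rewrite !ffunE eqxx.
  - by apply: ne_uv; rewrite -du.
have [e0 ue0] : exists e, (0 < u e)%N.
  apply: NNPP => no; apply: ne_uv.
  have u0 : u = zerox m.
    by apply/ffunP => e; rewrite ffunE; case: (posnP (u e)) => // ue; case: no; exists e.
  rewrite u0; apply/esym/(@vdeg_eq0 _ _ E); rewrite -min_vdeg u0.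
  by apply/ffunP => x; rewrite !ffunE big1 // => e _; rewrite ffunE.
have [q [vs [es [t [cyc le]]]]] := alternating_cycle simpleE min_vdeg le1 disj ue0.
exists q, vs, es; split=> //; rewrite B_wE eqf.
have := le false; have := le true; have eqd := toric_cycle cyc.
case: t {le} => /= l1 l2.
  have [<- <-] := min_primitive l1 l2 (esym eqd) (cycx_nz true cyc).
  by right; rewrite opprB.
have [<- <-] := min_primitive l2 l1 eqd (cycx_nz false cyc).
by left.
Qed.

End MinimalCycles.

(** * Edge weights vanishing on even cycles *)

Section Potential.
Variables (T : finType) (e : rel T) (Phi : T -> T -> rat).
Hypotheses (e_sym : symmetric e) (e_irr : irreflexive e).
Hypothesis Phi_sym : forall x y, Phi x y = Phi y x.

Fixpoint alt x s : rat := if s is y :: s' then Phi x y - alt y s' else 0.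

Hypothesis alt_even_cycle : forall x s, path e x (rcons s x) -> uniq (x :: s) ->
  odd (size s) -> (3 <= size s)%N -> alt x (rcons s x) = 0.

Implicit Types (p : T -> rat) (X Y U : {set T}).

(** The edges on which the potential [p] already accounts for the weight. *)
Definition coh p : rel T := fun a b => e a b && (Phi a b == p a + p b).

Lemma coh_sym p : symmetric (coh p).
Proof. by move=> a b; rewrite /coh e_sym Phi_sym addrC. Qed.

Lemma coh_path p x s : path (coh p) x s -> path e x s.
Proof. by apply: sub_path => a b /andP[]. Qed.

Lemma alt_coh p x s : path (coh p) x s ->
  alt x s = p x - (-1) ^+ size s * p (last x s).
Proof.
elim: s x => [|y s IH] x /=; first by rewrite expr0 mul1r subrr.
by move=> /andP[/andP[_ /eqP ->] /IH ->]; rewrite exprS; ring.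
Qed.

Lemma alt_cat x s t :
  alt x (s ++ t) = alt x s + (-1) ^+ size s * alt (last x s) t.
Proof.
elim: s x => [|y s IH] x /=; first by rewrite expr0 mul1r add0r.
by rewrite IH exprS; ring.
Qed.

(** Around an even cycle the potential telescopes away, so vanishing of the alternating sum forces
    the equation on the single edge not yet known to satisfy it. *)
Lemma coh_close p x zs y s :
  path (coh p) x zs -> e (last x zs) y -> path (coh p) y (rcons s x) ->
  uniq (x :: zs ++ y :: s) -> odd (size (zs ++ y :: s)) ->
  (3 <= size (zs ++ y :: s))%N -> coh p (last x zs) y.
Proof.
move=> P1 ezy P2 un od le3; rewrite /coh ezy /=.
have : alt x (rcons (zs ++ y :: s) x) = 0.
  apply: alt_even_cycle => //; rewrite rcons_cat cat_path (coh_path P1) /= ezy /=.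
  exact: coh_path P2.
rewrite rcons_cat rcons_cons alt_cat /= (alt_coh P1) (alt_coh P2) last_rcons.
rewrite size_rcons => H; move: od; rewrite size_cat oddD /= => od.
have sg : (-1) ^+ size zs * (-1) ^+ (size s).+1 = -1 :> rat.
  by rewrite -exprD -signr_odd oddD /= od.
have : (-1) ^+ size zs * (Phi (last x zs) y - (p (last x zs) + p y)) = 0.
  rewrite -[RHS]H.
  have -> : (-1) ^+ size zs * (Phi (last x zs) y - (p y - (-1) ^+ (size s).+1 * p x))
     = (-1) ^+ size zs * (Phi (last x zs) y - p y)
       + ((-1) ^+ size zs * (-1) ^+ (size s).+1) * p x by ring.
  by rewrite sg; ring.
by move/eqP; rewrite mulf_eq0 signr_eq0 /= subr_eq0.
Qed.

(** Each new vertex receives the value forced by the edge reaching it; distinctness of vertices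
    avoids conflicts. *)
Lemma coh_extend p x zs : path e x zs -> uniq (x :: zs) ->
  exists2 p', (forall t, t \notin zs -> p' t = p t) & path (coh p') x zs.
Proof.
elim: zs x p => [|z zs IH] x p; first by exists p.
move=> /= /andP[exz P] /andP[nx /andP[nz un]].
pose p1 t := if t == z then Phi x z - p x else p t.
have [|p' agree P'] := IH z p1 P; first by rewrite /= nz.
exists p' => [t|].
  by rewrite inE negb_or => /andP[/negPf tz /agree ->]; rewrite /p1 tz.
rewrite P' andbT /coh exz /= !agree //; last first.
  by move: nx; rewrite inE negb_or => /andP[].
rewrite /p1 eqxx; case: (x =P z) => [xz|_]; first by rewrite xz e_irr in exz.
by rewrite addrC subrK.
Qed.

Definition spath p X a b (c : bool) := exists s,
  [/\ path (coh p) a s, last a s = b, uniq (a :: s), {subset a :: s <= X}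
    & odd (size s) = c].

Lemma spath_sub p X Y a b c : X \subset Y -> spath p X a b c -> spath p Y a b c.
Proof.
by move=> /subsetP XY [s [? ? ? sX ?]]; exists s; split=> // t /sX/XY.
Qed.

Lemma spath_eq p p' X a b c : {in X, p =1 p'} ->
  spath p X a b c -> spath p' X a b c.
Proof.
move=> pp' [s [P l un sX o]]; exists s; split=> //.
apply: sub_in_path P => [t t' /sX Xt /sX Xt'|]; last by apply/allP.
by rewrite /coh !pp'.
Qed.

Lemma spath_sym p X a b c : spath p X a b c -> spath p X b a c.
Proof.
move=> [s [P l un sX o]]; exists (rev (belast a s)).
have eqr : b :: rev (belast a s) = rev (a :: s) by rewrite (lastI a s) rev_rcons l.
split.
- rewrite -l rev_path; apply: sub_path P => t t' /=.
  by rewrite coh_sym.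
- by rewrite -l; case: (s) => //= y s'; rewrite rev_cons last_rcons.
- by rewrite eqr rev_uniq.
- by move=> t; rewrite eqr mem_rev => /sX.
- by rewrite size_rev size_belast.
Qed.

Lemma spath_cat p X Y a b d c1 c2 : spath p X a b c1 -> spath p Y b d c2 ->
  (forall t, t \in X -> t \in Y -> t = b) -> spath p (X :|: Y) a d (c1 (+) c2).
Proof.
move=> [s [P1 l1 un1 sX o1]] [s' [P2 l2 un2 sY o2]] XY; exists (s ++ s').
split.
- by rewrite cat_path P1 l1.
- by rewrite last_cat l1.
- rewrite -cat_cons cat_uniq un1; move: un2 => /= /andP[nb ->]; rewrite andbT.
  apply/hasPn => t ts'; apply/negP => /sX Xt; case/negP: nb.
  by rewrite -(XY t Xt) //; apply: sY; rewrite inE ts' orbT.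
- move=> t; rewrite in_setU -cat_cons mem_cat => /orP[/sX -> //|ts'].
  by rewrite sY ?orbT // inE ts' orbT.
- by rewrite size_cat oddD o1 o2.
Qed.

(* [nb] records whether the graph has an odd cycle: if it does, coherent simple
   paths of both parities are required; if not, one path is enough. *)
Variable nb : bool.
Hypothesis no_odd_cycle : forall x s, path e x (rcons s x) -> uniq (x :: s) ->
  ~~ odd (size s) -> nb.

Definition linked p X a b :=
  exists c0, forall c, nb || (c == c0) -> spath p X a b c.

Lemma linked_sub p X Y a b : X \subset Y -> linked p X a b -> linked p Y a b.
Proof. by move=> XY [c0 H]; exists c0 => c /H; apply: spath_sub. Qed.

Lemma linked_sym p X a b : linked p X a b -> linked p X b a.
Proof. by move=> [c0 H]; exists c0 => c /H; apply: spath_sym. Qed.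

(** Appending a path of fixed parity only shifts the available parities, so none is lost. *)
Lemma linked_cat p X Y a b d c : linked p X a b -> spath p Y b d c ->
  (forall t, t \in X -> t \in Y -> t = b) -> linked p (X :|: Y) a d.
Proof.
move=> [c0 H] P XY; exists (c0 (+) c) => c1 Hc.
rewrite -[c1](addbK c); apply: spath_cat P XY; apply: H.
by case: nb Hc => //= /eqP ->; rewrite addbK.
Qed.

Definition coherent p U := {in U &, forall a b, a != b -> linked p U a b}.

(** A coherent path in [U] from [b] back to [a] of odd length closes with the edge to an even cycle,
    and [coh_close] applies. When [nb] is false the parity is automatic, since an even path would
    create an odd cycle. *)
Lemma coherent_edge p U a b : coherent p U -> a \in U -> b \in U -> e a b ->
  coh p a b.
Proof.
move=> inv aU bU eab; have ne : b != a by apply: contraTneq eab => ->; rewrite e_irr.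
have [c0 H] := inv b a bU aU ne.
have [|s [P l un _ od]] := H (nb || c0); first by case: nb; case: c0 {H}.
case/lastP: s P l un od => [|s t]; first by move=> _ /= ba; rewrite ba eqxx in ne.
rewrite last_rcons => P ta un od; rewrite {t}ta in P un od.
have un' : uniq (a :: b :: s).
  by move: un; rewrite -rcons_cons rcons_uniq /=.
have cyc : path e a (rcons (b :: s) a) by rewrite /= eab (coh_path P).
case o: (odd (size s)).
  have nbT := no_odd_cycle cyc un'; rewrite /= o /= in nbT.
  by rewrite size_rcons /= o nbT in od.
case: s P un un' {od cyc} o => [|t s] P un un' o.
  by move: P; rewrite /= andbT coh_sym.
apply: (@coh_close p a [::] b (t :: s)) => //=.
  by move: o => /= ->.
by move: o; case: (s).
Qed.

Lemma ear_segments p x zs y : path (coh p) x (rcons zs y) ->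
  uniq (x :: rcons zs y) -> forall l1 z l2, zs = l1 ++ z :: l2 ->
  (exists c, spath p [set t in x :: rcons l1 z] x z c) /\
  (exists c, spath p [set t in z :: rcons l2 y] y z c).
Proof.
move=> P un l1 z l2 ez; move: P un; rewrite ez rcons_cat rcons_cons -cat_rcons cat_path.
move=> /andP[P1]; rewrite last_rcons => P2 un; split.
  exists (odd (size (rcons l1 z))), (rcons l1 z); split=> //.
  - by rewrite last_rcons.
  - by move: un; rewrite -cat_cons cat_uniq => /andP[].
  - by move=> t ts; rewrite inE.
exists (odd (size (rcons l2 y))); apply: spath_sym; exists (rcons l2 y); split=> //.
- by rewrite last_rcons.
- by move: un; rewrite /= cat_rcons cat_uniq => /and4P[].
- by move=> t ts; rewrite inE.
Qed.

(** The potential is pushed along the ear from [x]; its last edge becomes coherent by closing up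
    through [U] along a path of suitable parity. *)
Lemma ear_extend p U x zs y : coherent p U -> x \in U -> y \in U -> x != y ->
  (0 < size zs)%N -> uniq zs -> {in zs, forall t, t \notin U} ->
  path e x (rcons zs y) -> exists p', coherent p' (U :|: [set t in zs]).
Proof.
move=> inv xU yU ne_xy zs0 unz zU Pe.
have nxz : x \notin zs by apply/negP => /zU; rewrite xU.
have nyz : y \notin zs by apply/negP => /zU; rewrite yU.
move: (Pe); rewrite rcons_path => /andP[Pz ezy].
have [|p' agree P'] := coh_extend p Pz; first by rewrite /= nxz.
have inv' : coherent p' U.
  move=> a b aU bU ne; have [c0 H] := inv a b aU bU ne; exists c0 => c /H.
  by apply: spath_eq => t tU; rewrite agree //; apply/negP => /zU; rewrite tU.
have close : coh p' (last x zs) y.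
  have [c0 H] := inv' y x yU xU (contra_neq esym ne_xy).
  have [|s [P l un sU od]] := H (if nb then ~~ odd (size zs) else c0).
    by case: nb => //=.
  case/lastP: s P l un sU od => [|s t]; first by move=> _ /= yx; rewrite yx eqxx in ne_xy.
  rewrite last_rcons => P tx un sU od; rewrite {t}tx in P un sU od.
  have un' : uniq (x :: zs ++ y :: s).
    have [nx' un1] : x \notin y :: s /\ uniq (y :: s).
      by apply/andP; move: un; rewrite -rcons_cons rcons_uniq.
    have hs : ~~ has (mem zs) (y :: s).
      apply/hasPn => t ts; apply/negP => /zU /negP; apply; apply: sU.
      by rewrite -rcons_cons mem_rcons inE ts orbT.
    by rewrite cons_uniq mem_cat negb_or nxz nx' cat_uniq unz hs un1.
  have cyc : path e x (rcons (zs ++ y :: s) x).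
    by rewrite rcons_cat cat_path Pz /= ezy (coh_path P).
  have odc : odd (size (zs ++ y :: s)).
    apply: contraT => ev; have nbT := no_odd_cycle cyc un' ev.
    move: ev od; rewrite nbT size_cat size_rcons oddD /=.
    by case: (odd (size zs)); case: (odd (size s)).
  have le3 : (3 <= size (zs ++ y :: s))%N.
    move: odc zs0; rewrite size_cat /= ; clear.
    by move: (size zs) (size s) => k l; lia.
  exact: coh_close P' ezy P un' odc le3.
have Pc : path (coh p') x (rcons zs y) by rewrite rcons_path P' close.
have unc : uniq (x :: rcons zs y).
  by rewrite /= mem_rcons inE negb_or ne_xy nxz rcons_uniq nyz unz.
have seg := ear_segments Pc unc.
exists p'; set U' := U :|: _.
have UU' : U \subset U' by apply: subsetUl.
(* From [a] go inside [U] to an end of the ear different from [a], then along the ear to [z]. *)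
have one a z : a \in U -> z \in zs -> linked p' U' a z.
  move=> aU /splitPr ez; case: ez seg zU nxz nyz @U' UU' => l1 l2 seg zU nxz nyz U' UU'.
  have [[c1 S1] [c2 S2]] := seg _ _ _ erefl.
  have inU' t : t \in l1 ++ z :: l2 -> t \in U' by move=> tz; rewrite !inE tz orbT.
  have [ax|nax] := eqVneq a x.
    have nay : a != y by rewrite ax.
    apply: linked_sub (linked_cat (inv' _ _ aU yU nay) S2 _).
      apply/subsetP => t; rewrite in_setU => /orP[/(subsetP UU') //|].
      rewrite inE -rcons_cons mem_rcons inE => /orP[/eqP ->|tz].
        exact: (subsetP UU').
      by apply: inU'; rewrite mem_cat tz orbT.
    move=> t tU; rewrite inE -rcons_cons mem_rcons inE => /orP[/eqP //|tz].
    by have := zU t; rewrite mem_cat tz orbT tU => /(_ isT).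
  apply: linked_sub (linked_cat (inv' _ _ aU xU nax) S1 _).
    apply/subsetP => t; rewrite in_setU => /orP[/(subsetP UU') //|].
    rewrite inE in_cons => /orP[/eqP ->|tz]; first exact: (subsetP UU').
    by apply: inU'; rewrite -cat_rcons mem_cat tz.
  move=> t tU; rewrite inE in_cons => /orP[/eqP //|tz].
  by have := zU t; rewrite -cat_rcons mem_cat tz tU => /(_ isT).
(* The route leaves [z] backwards to [x], crosses [U] to [y] and comes back to [z']: only the part
   inside [U] offers both parities. *)
have two l1 z l2 z' l3 : zs = l1 ++ z :: l2 ++ z' :: l3 -> linked p' U' z z'.
  move=> ez; have [[c1 S1] _] := seg _ _ _ ez.
  have ez' : zs = (l1 ++ z :: l2) ++ z' :: l3 by rewrite -catA.
  have [_ [c2 S2]] := seg _ _ _ ez'.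
  have inz1 t : t \in rcons l1 z -> t \in zs.
    by move=> tz; rewrite ez -cat_rcons mem_cat tz.
  have inz2 t : t \in z' :: l3 -> t \in zs.
    by move=> tz; rewrite ez' mem_cat tz orbT.
  have dis t : t \in rcons l1 z -> t \in z' :: l3 -> False.
    move: unz; rewrite ez -cat_rcons catA cat_uniq => /and3P[_ /hasPn H _] t1 t2.
    by have := H t t2; rewrite /= mem_cat t1.
  have L1 : linked p' (U :|: [set t in x :: rcons l1 z]) z y.
    apply/linked_sym/(linked_cat (inv' _ _ yU xU (contra_neq esym ne_xy)) S1).
    move=> t tU; rewrite inE in_cons => /orP[/eqP //|/inz1/zU].
    by rewrite tU.
  apply: linked_sub (linked_cat L1 S2 _).
    apply/subsetP => t; rewrite !inE => /orP[/orP[-> //|/orP[/eqP ->|]]|].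
    - by rewrite xU.
    - by move=> /inz1 ->; rewrite orbT.
    rewrite -[_ || _]/(t \in z' :: rcons l3 y) -rcons_cons mem_rcons in_cons.
    by move=> /orP[/eqP ->|/inz2 ->]; rewrite ?yU ?orbT.
  move=> t H; rewrite in_set -rcons_cons mem_rcons in_cons => /orP[/eqP //|t2].
  move: H; rewrite in_setU in_set in_cons.
  case/orP => [tU|/orP[/eqP tx|t1]]; last by case: (dis t t1 t2).
    by have := zU t (inz2 _ t2); rewrite tU.
  by have := zU t (inz2 _ t2); rewrite tx xU.
move=> a b; rewrite in_setU => Ha; rewrite in_setU => Hb ne.
case/orP: Ha => [aU|]; case/orP: Hb => [bU|]; rewrite ?inE.
- exact: linked_sub UU' (inv' _ _ aU bU ne).
- exact: one.
- by move=> az; apply/linked_sym/one.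
move=> bz /splitPr az; case: az bz two => l1 l2; rewrite mem_cat in_cons eq_sym (negPf ne) /=.
case/orP => /splitPr [l3 l4] two; last exact: (two _ _ _ _ _ erefl).
by apply/linked_sym/(two l3 b l4 a l2); rewrite -catA.
Qed.

Hypothesis conn : forall x y, connect e x y.
Hypothesis biconn : forall v x y, x != v -> y != v ->
  connect (fun a b => [&& a != v, b != v & e a b]) x y.

(** Connectedness gives an edge leaving [U] at [x]. As [x] is no cut vertex, its outer end still
    reaches [U] while avoiding [x], and the ear stops at the first vertex of [U]. *)
Lemma ear_exists U a b : a \in U -> b \in U -> a != b -> U != setT ->
  exists x zs y, [/\ x \in U, y \in U, x != y, (0 < size zs)%N & uniq zs] /\
    {in zs, forall t, t \notin U} /\ path e x (rcons zs y).
Proof.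
move=> aU bU ne UT.
have [w wU] : exists w, w \notin U.
  apply: NNPP => no; case/eqP: UT; apply/setP => w; rewrite inE.
  by apply: contraT => wU; case: no; exists w.
have [x [z [xU zU exz]]] : exists x z, [/\ x \in U, z \notin U & e x z].
  have /connectP[s P l] := conn a w; rewrite l in wU.
  elim: s a aU P wU {l ne} => [|t s IH] a aU /=; first by rewrite aU.
  move=> /andP[eat P]; case: (boolP (t \in U)) => [tU|tU _]; first exact: IH.
  by exists a, t.
have [u uU nux] : exists2 u, u \in U & u != x.
  by have [ax|] := eqVneq a x; [exists b; rewrite // -ax eq_sym | exists a].
have nzx : z != x by apply: contraNneq zU => ->.
have /connectP[s0 P0 l0] := biconn nzx nux.
case/shortenP: P0 l0 => s P un _ l.
have [s1 [y [s2 [es s1U yU]]]] : exists s1 y s2,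
    [/\ s = s1 ++ y :: s2, {in s1, forall t, t \notin U} & y \in U].
  have hs : has (mem U) s.
    apply/hasP; exists u => //; rewrite l; case: (s) l => [|t s']; last by rewrite /= mem_last.
    by move=> /= uz; rewrite uz (negPf zU) in uU.
  case/split_find: hs => y s1 s2 yU no; exists s1, y, s2; split=> //.
    by rewrite cat_rcons.
  by move=> t ts1; apply: contra no => tU; apply/hasP; exists t.
exists x, (z :: s1), y.
move: P un; rewrite es => P un.
have yx : y != x.
  move: P; rewrite cat_path /= => /and3P[_ /and3P[_ yx _] _]; exact: yx.
split; first split=> //.
- by rewrite eq_sym.
- by move: un; rewrite -cat_cons cat_uniq => /andP[].
split=> [t|]; first by rewrite in_cons => /orP[/eqP ->|/s1U].
rewrite /= exz /=; move: P; rewrite -cat_rcons cat_path => /andP[P _].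
by apply: sub_path P => t t' /and3P[].
Qed.

Lemma coherent_grow p U a b : a \in U -> b \in U -> a != b -> coherent p U ->
  exists p', coherent p' setT.
Proof.
move: {2}#|~: U| (leqnn #|~: U|) => k.
elim: k U p => [|k IH] U p le aU bU ne inv.
  exists p; suff <- : U = setT by [].
  by apply: setC_inj; rewrite setCT; apply/eqP; rewrite -cards_eq0 -leqn0.
have [<-|UT] := eqVneq U setT; first by exists p.
have [x [zs [y [[xU yU ne_xy zs0 un] [zU P]]]]] := ear_exists aU bU ne UT.
have [p' inv'] := ear_extend inv xU yU ne_xy zs0 un zU P.
apply: (IH _ p') inv' => //; rewrite ?in_setU ?aU ?bU //.
rewrite -ltnS; apply: leq_trans le; apply: proper_card; rewrite setCU.
case: zs zs0 zU {un P} => // z zs _ zU; apply/properP; split; first exact: subsetIl.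
exists z; first by rewrite inE zU ?mem_head.
by rewrite !inE eqxx /= andbF.
Qed.

(** The value at [x] solves the closing equation, where [p x] occurs twice; hence the division by 2.
    The two arcs between distinct vertices have opposite parities. *)
Lemma coherent_odd_cycle x s : path e x (rcons s x) -> uniq (x :: s) ->
  ~~ odd (size s) -> exists p, coherent p [set t in x :: s].
Proof.
move=> Pc un ev; move: (Pc); rewrite rcons_path => /andP[P elx].
pose p0 (t : T) : rat := (Phi (last x s) x + alt x s) / 2%:R.
have [p agree Pp] := coh_extend p0 P un; exists p.
have px : p x = (Phi (last x s) x + alt x s) / 2%:R.
  by apply: agree; case/andP: un.
have cl : coh p (last x s) x.
  rewrite /coh elx /=; have := alt_coh Pp; rewrite -signr_odd (negPf ev) expr0 mul1r.
  by move=> H; apply/eqP; lra.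
have Cp : cycle (coh p) (x :: s) by rewrite /= rcons_path Pp.
move=> a b; rewrite !in_set => ax bx ne.
have [i s' er] := rot_to ax.
have b' : b \in s'.
  have : b \in rot i (x :: s) by rewrite mem_rot.
  by rewrite er in_cons eq_sym (negPf ne).
have szs : size s' = size s.
  by have := congr1 size er; rewrite size_rot /= => -[].
have un' : uniq (a :: s') by rewrite -er rot_uniq.
have inX t : t \in a :: s' -> t \in [set t in x :: s].
  by rewrite -er mem_rot in_set.
move: Cp; rewrite -(rot_cycle i) er /=.
case/splitPr: b' szs un' inX => s1 s2 szs un' inX.
rewrite -cat_rcons rcons_cat cat_path last_rcons => /andP[P1 P2].
have S1 : spath p [set t in x :: s] a b (odd (size s1).+1).
  exists (rcons s1 b); split=> //; rewrite ?last_rcons ?size_rcons //.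
    by move: un'; rewrite -cat_rcons -cat_cons cat_uniq => /andP[].
  by move=> t ts; apply: inX; rewrite -cat_rcons -cat_cons mem_cat ts.
have S2 : spath p [set t in x :: s] a b (odd (size s2).+1).
  apply: spath_sym; exists (rcons s2 a); split=> //; rewrite ?last_rcons ?size_rcons //.
    rewrite -rcons_cons rcons_uniq; move: un' => /= /andP[].
    rewrite mem_cat negb_or cat_uniq => /andP[_ ->] /and3P[_ _].
    by rewrite /= => ->.
  move=> t; rewrite -rcons_cons mem_rcons in_cons => /orP[/eqP ->|ts].
    by apply: inX; rewrite mem_head.
  by apply: inX; rewrite in_cons mem_cat ts !orbT.
exists true => c _; move: ev; rewrite -szs size_cat /= addnS /= oddD.
move: S1 S2 => /=.
by case: (odd (size s1)); case: (odd (size s2)); case: c.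
Qed.

Lemma coherent_single_edge a b : ~~ nb -> e a b ->
  exists p, coherent p [set a; b].
Proof.
move=> /negPf nbF eab; pose p t := if t == a then Phi a b else 0.
have nba : b == a = false by apply: contraTF eab => /eqP ->; rewrite e_irr.
have L : linked p [set a; b] a b.
  exists true => c; rewrite nbF => /eqP ->; exists [:: b]; split=> //=.
  - by rewrite /coh eab /p eqxx nba addr0 eqxx.
  - by rewrite inE eq_sym nba.
  - by move=> t; rewrite !inE.
exists p => x y; rewrite !inE => /orP[]/eqP -> /orP[]/eqP ->; rewrite ?eqxx // => _.
exact: linked_sym.
Qed.

End Potential.

(** Growth by ears starts from an odd cycle if there is one, and from a single edge otherwise. *)
Lemma even_cycles_potential (T : finType) (e : rel T) (Phi : T -> T -> rat) :
  symmetric e -> irreflexive e -> (forall x y, Phi x y = Phi y x) ->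
  (forall x s, path e x (rcons s x) -> uniq (x :: s) ->
     odd (size s) -> (3 <= size s)%N -> alt Phi x (rcons s x) = 0) ->
  (forall x y, connect e x y) ->
  (forall v x y, x != v -> y != v ->
    connect (fun a b => [&& a != v, b != v & e a b]) x y) ->
  exists p : T -> rat, forall x y, e x y -> Phi x y = p x + p y.
Proof.
move=> e_sym e_irr Phi_sym alt0 conn biconn.
have [[a [b eab]]|no] := classic (exists a b, e a b); last first.
  by exists (fun=> 0) => x y exy; case: no; exists x, y.
pose odd_cyc := exists x s, [/\ path e x (rcons s x), uniq (x :: s) & ~~ odd (size s)].
have fin (nb : bool) (U : {set T}) p a' b' : (odd_cyc -> nb) -> a' \in U -> b' \in U ->
    a' != b' -> coherent e Phi nb p U ->
    exists p : T -> rat, forall x y, e x y -> Phi x y = p x + p y.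
  move=> Hnb aU bU ne inv.
  have noc x s : path e x (rcons s x) -> uniq (x :: s) -> ~~ odd (size s) -> nb.
    by move=> *; apply: Hnb; exists x, s.
  have [p' inv'] := coherent_grow e_sym e_irr Phi_sym alt0 noc conn biconn aU bU ne inv.
  exists p' => x y exy.
  have := coherent_edge e_sym e_irr Phi_sym alt0 noc inv' (in_setT x) (in_setT y) exy.
  by case/andP => _ /eqP.
have [[x [s [P un ev]]]|nooc] := classic odd_cyc; last first.
  have [p inv] := @coherent_single_edge T e Phi e_sym e_irr Phi_sym false a b isT eab.
  apply: (@fin false _ p a b) inv => //; rewrite ?inE ?eqxx ?orbT //.
  by apply: contraTneq eab => ->; rewrite e_irr.
have [p inv] := @coherent_odd_cycle T e Phi e_sym e_irr Phi_sym true x s P un ev.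
case: s P un ev inv => [|t s] P un ev inv; first by move: P; rewrite /= e_irr.
apply: (@fin true _ p x t) inv => //; rewrite ?inE ?eqxx ?orbT //.
by move: un; rewrite /= in_cons negb_or -andbA => /andP[].
Qed.

(** * The complete intersection case *)

Definition wt m (phi : 'I_m -> rat) (a : expo m) : rat := \sum_e phi e * (a e)%:R.

Lemma wtD m phi (a b : expo m) : wt phi (addx a b) = wt phi a + wt phi b.
Proof.
by rewrite -big_split; apply: eq_bigr => e _; rewrite ffunE natrD mulrDr.
Qed.

Section CycleWeight.
Variables (K : fieldType) (n m : nat) (E : 'I_m -> 'I_n * 'I_n).
Variables (S : mpoly K m -> Prop) (phi : 'I_m -> rat).
Hypothesis genS : generates S (toric_ideal K E).
Variables (f : mpoly K m) (u v : expo m) (x0 : 'I_n).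
Hypothesis eqf : f = monomial K u - monomial K v.
Hypothesis deg_f : (1 < vdeg E u x0)%N.
Hypothesis phiS : forall t, S t -> t <> f ->
  exists a b : expo m, t = monomial K a - monomial K b /\ wt phi a = wt phi b.

(* A square-free degree leaves no room for f, so only the generators of
   weight zero contribute to the binomial of an even cycle. *)
Lemma even_cycle_wt q (vs : 'I_(q.*2) -> 'I_n) (es : 'I_(q.*2) -> 'I_m) :
  even_cycle E vs es -> wt phi (cycx es false) = wt phi (cycx es true).
Proof.
move=> cyc; set a0 := cycx es false; set a1 := cycx es true.
(* The functional tests membership in one class of degree and weight; if it kills the ideal, both
   monomials of the cycle lie in the same class. *)
pose P (a : expo m) := (vdeg E a == vdeg E a0) && (wt phi a == wt phi a0).
pose w (a : expo m) : K := (P a)%:R.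
have kill g t : S t -> Lam w (g * t) = 0.
  move=> St; have [a [b [et eqP]]] : exists a b : expo m,
      t = monomial K a - monomial K b /\ forall c, P (addx c a) = P (addx c b).
    have vd (a b : expo m) : t = monomial K a - monomial K b -> vdeg E a = vdeg E b.
      by move=> et; apply/(toric_binomial K); rewrite -et; apply/genS/gen_mem.
    case: (eqVneq t f) => [tf|/eqP ne].
      exists u, v; split; first by rewrite tf.
      have nP d c : vdeg E d = vdeg E u -> P (addx c d) = false.
        move=> ed; apply/negP => /andP[/eqP H _].
        have := vdeg_cycx_le1 false x0 cyc; rewrite -/a0 -H vdegD ffunE ed.
        by move: deg_f; lia.
      by move=> c; rewrite !nP // (vd u v) // tf.
    have [a [b [et ew]]] := phiS St ne; exists a, b; split=> // c.
    by rewrite /P !vdegD !wtD (vd _ _ et) ew.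
  move: g; apply: monomial_span => [|p p' Hp Hp'|c b'].
  - by rewrite mul0r Lam0.
  - by rewrite mulrDl LamD Hp Hp' addr0.
  by rewrite -mulrA Lam_const et mulrBr -!monomialD LamB !Lam_monomial /w eqP subrr mulr0.
have : Lam w (monomial K a0 - monomial K a1) = 0.
  have /genS : toric_ideal K E (monomial K a0 - monomial K a1).
    by apply/toric_binomial; apply: toric_cycle cyc.
  move: (_ - _); apply: gen_ind => [|p p' Hp Hp'|c x]; first exact: Lam0.
    by rewrite LamD Hp Hp' addr0.
  exact: kill.
rewrite LamB !Lam_monomial /w {1}/P !eqxx /= => /eqP; rewrite subr_eq0.
case Pa: (P a1); last by rewrite oner_eq0.
by case/andP: Pa => _ /eqP.
Qed.

End CycleWeight.

Lemma alt_sum (T : finType) (Phi : T -> T -> rat) d x s :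
  alt Phi x s =
  \sum_(i < size s) (-1) ^+ i * Phi (nth d (x :: s) i) (nth d s i).
Proof.
elim: s x => [|y s IH] x /=; first by rewrite big_ord0.
rewrite big_ord_recl /= expr0 mul1r IH -sumrN; congr (_ + _).
by apply: eq_bigr => i _; rewrite exprS mulN1r mulNr.
Qed.

Section EdgeWeights.
Variables (n m : nat) (E : 'I_m -> 'I_n * 'I_n) (phi : 'I_m -> rat).
Hypothesis simpleE : simple_edges E.

Definition joins (i : 'I_m) x y := (E i == (x, y)) || (E i == (y, x)).

(** The weight as a symmetric function of endpoints, with default 0 on non-adjacent pairs. *)
Definition pairwt x y : rat := if [pick i | joins i x y] is Some i then phi i else 0.

Lemma joinsC i x y : joins i x y = joins i y x.
Proof. by rewrite /joins orbC. Qed.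

Lemma pairwtC x y : pairwt x y = pairwt y x.
Proof. by rewrite /pairwt (eq_pick (fun i => joinsC i x y)). Qed.

Lemma pairwtE i x y : joins i x y -> pairwt x y = phi i.
Proof.
have [inj lt] := simpleE => Hi; rewrite /pairwt; case: pickP => [j Hj|/(_ i)]; last by rewrite Hi.
congr phi; apply: inj; have := lt i; have := lt j.
by case/orP: Hi => /eqP ->; case/orP: Hj => /eqP -> //=; lia.
Qed.

Lemma adj_sym : symmetric (adj E).
Proof. by move=> x y; apply: eq_existsb => i; rewrite orbC. Qed.

Lemma adj_irr : irreflexive (adj E).
Proof.
have [_ lt] := simpleE => x; apply/negbTE/negP => /existsP[i].
by have := lt i; rewrite orbb => lti /eqP Ei; rewrite Ei ltnn in lti.
Qed.

Lemma seq_even_cycle x s : path (adj E) x (rcons s x) -> uniq (x :: s) ->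
  odd (size s) -> (3 <= size s)%N ->
  exists (q : nat) (vs : 'I_(q.*2) -> 'I_n) (es : 'I_(q.*2) -> 'I_m),
    even_cycle E vs es /\
    alt pairwt x (rcons s x) = wt phi (cycx es false) - wt phi (cycx es true).
Proof.
move=> P un od le3; pose q := (size s).+1./2.
have q2 : q.*2 = (size s).+1 by rewrite /q -[RHS]odd_double_half /= od.
pose vs (k : 'I_(q.*2)) := nth x (x :: s) k.
have nextE (k : 'I_(q.*2)) : nth x (rcons s x) k = vs (ordS k).
  rewrite /vs; case: k => k /= lt_k; rewrite nth_rcons q2.
  move: lt_k; rewrite q2 ltnS leq_eqVlt => /orP[/eqP ->|lt]; first by rewrite ltnn eqxx modnn.
  by rewrite lt modn_small.
have curE (k : 'I_(q.*2)) : nth x (x :: rcons s x) k = vs k.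
  rewrite /vs; case: k => k /= lt_k; rewrite -rcons_cons nth_rcons /=.
  by rewrite -q2 lt_k.
have exe (k : 'I_(q.*2)) : exists i, joins i (vs k) (vs (ordS k)).
  apply/existsP; have /(pathP x)/(_ k) := P; rewrite size_rcons.
  by rewrite -[X in (_ < X)%N]q2 ltn_ord curE nextE; apply.
have [es Hes] := fin_all_exists exe; exists q, vs, es; split.
  split; first by lia.
  split=> [k l /eqP|k].
    by rewrite nth_uniq //= -?q2 ?ltn_ord // => /eqP/val_inj.
  exists (ltn_ord (ordS k)); have := Hes k.
  by have -> : Ordinal (ltn_ord (ordS k)) = ordS k by apply: val_inj.
have wtc c : wt phi (cycx es c) = \sum_(k < q.*2 | odd k == c) phi (es k).
  rewrite /wt; under eq_bigr => e _ do rewrite ffunE natr_sum mulr_sumr.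
  rewrite exchange_big /=; apply: eq_bigr => k _.
  rewrite (bigD1 (es k)) //= eqxx mulr1 big1 ?addr0 // => e.
  by rewrite eq_sym => /negPf ->; rewrite mulr0.
rewrite (alt_sum _ x) size_rcons -q2 !wtc.
rewrite (bigID (fun k : 'I_(q.*2) => odd k == false)) /= -sumrN.
congr (_ + _); [apply: eq_bigr | apply: eq_big] => k.
- by rewrite curE nextE (pairwtE (Hes k)) -signr_odd => /eqP ->; rewrite expr0 mul1r.
- by case: (odd k).
by rewrite curE nextE (pairwtE (Hes k)) -signr_odd; case: (odd k) => // _; rewrite expr1 mulN1r.
Qed.

Lemma biconnected_potential : biconnected E ->
  (forall q (vs : 'I_(q.*2) -> 'I_n) (es : 'I_(q.*2) -> 'I_m),
     even_cycle E vs es -> wt phi (cycx es false) = wt phi (cycx es true)) ->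
  exists p : 'I_n -> rat, forall e, phi e = p (E e).1 + p (E e).2.
Proof.
move=> [conn nocut] cyc0.
have [||||||p Hp] := @even_cycles_potential 'I_n (adj E) pairwt.
- exact: adj_sym.
- exact: adj_irr.
- exact: pairwtC.
- move=> x s P un od le3.
  by have [q [vs [es [/cyc0 H ->]]]] := seq_even_cycle P un od le3; rewrite H subrr.
- move=> x y; have := conn x y (in_setT _) (in_setT _).
  by rewrite (eq_connect (e' := adj E)) // => a b; rewrite !in_setT.
- move=> v x y xv yv; have Hv := NNPP _ (nocut v).
  have := Hv x y; rewrite !inE xv yv => /(_ isT isT).
  by congr (is_true _); apply: eq_connect => a b; rewrite !inE.
exists p => e; rewrite -Hp; last by apply/existsP; exists e; rewrite -surjective_pairing eqxx.
by rewrite (pairwtE (i := e)) // /joins -surjective_pairing eqxx.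
Qed.

End EdgeWeights.

Theorem theorem5p3 (K : fieldType) (n m : nat) (E : 'I_m -> 'I_n * 'I_n) :
  simple_edges E -> biconnected E -> complete_intersection K E ->
  forall f : mpoly K m, minimal_generator (toric_ideal K E) f ->
  exists (q : nat) (vs : 'I_(q.*2) -> 'I_n) (es : 'I_(q.*2) -> 'I_m),
    even_cycle E vs es /\ (f = B_w K es \/ f = - B_w K es).
Proof.
move=> simpleE biE [h [htI [gs [szgs gengs]]]] f [S [minS Sf]].
have [binS genS _] := minS.
have [u [v eqf]] := is_binomialP (binS _ Sf).
apply: NNPP => not_cycle.
have [x0 deg_f] : exists x, (1 < vdeg E u x)%N.
  apply: NNPP => no; apply: not_cycle; apply: (min_le1_even_cycle simpleE minS Sf eqf).
  by move=> x; rewrite leqNgt; apply/negP => lt; apply: no; exists x.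
have [T [uT ST szT]] := min_system_bound minS gengs.
have fT : f \in T by apply/ST.
pose T' := rem f T.
have szT' : size T' = (size T).-1 by rewrite size_rem.
have exT (i : 'I_(size T')) : exists ab : expo m * expo m,
    T'`_i = monomial K ab.1 - monomial K ab.2.
  have : T'`_i \in T by apply: (mem_subseq (rem_subseq f T)); apply: mem_nth.
  by move/ST/binS/is_binomialP => [a [b ->]]; exists (a, b).
have [ab Hab] := fin_all_exists exT.
(* The rows are the exponent vectors of the generators other than [f]. *)
pose N : 'M[rat]_(size T', m) := \matrix_(i, e) (((ab i).1 e)%:R - ((ab i).2 e)%:R).
have ker_inc : (kermx N^T <= (incmx E)^T)%MS.
  apply/rV_subP => phi /sub_kermxP phiN.
  have phiS t : S t -> t <> f -> exists a b : expo m,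
      t = monomial K a - monomial K b /\ wt (phi 0) a = wt (phi 0) b.
    move=> /ST tT /eqP ne; have /(nthP 0)[i lt_i <-] : t \in T'.
      by rewrite mem_rem_uniq // inE ne.
    exists (ab (Ordinal lt_i)).1, (ab (Ordinal lt_i)).2; split.
      exact: (Hab (Ordinal lt_i)).
    apply/eqP; rewrite -subr_eq0 -sumrB; apply/eqP.
    have /rowP/(_ (Ordinal lt_i)) := phiN; rewrite mxE [RHS]mxE => sum0.
    by rewrite -[RHS]sum0; apply: eq_bigr => e _; rewrite !mxE mulrBr.
  have cyc0 := even_cycle_wt genS eqf deg_f phiS.
  have [p Hp] := biconnected_potential simpleE biE cyc0.
  apply/submxP; exists (\row_x p x); apply/rowP => e; rewrite Hp mxE.
  under eq_bigr => x _ do rewrite !mxE natrD mulrDr.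
  rewrite big_split /=; congr (_ + _).
    rewrite (bigD1 (E e).1) //= eqxx mulr1 big1 ?addr0 // => x.
    by rewrite eq_sym => /negPf ->; rewrite mulr0.
  rewrite (bigD1 (E e).2) //= eqxx mulr1 big1 ?addr0 // => x.
  by rewrite eq_sym => /negPf ->; rewrite mulr0.
(* The inclusion gives [m - \rank N <= \rank (incmx E)] with [\rank N] at most [size T - 1], while
   the height bound gives [\rank (incmx E) + size T <= m]. *)
have := mxrankS ker_inc; rewrite mxrank_ker !mxrank_tr.
have := rank_leq_row N; have := toric_height_le htI.
have : (0 < size T)%N by case: (T) fT.
by lia.
Qed.
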